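(* Let $K$ be a field, let $G$ be a Cameron--Walker graph with parameters $m,n,s_1,\dots,s_m,t_1,\dots,t_n$ in the standard labeling, and let $S=K[V(G)]$. Then $\deg h(S/I(G),\lambda)\ge\operatorname{reg}(S/I(G))$. Moreover, the equality $\deg h(S/I(G),\lambda)=\operatorname{reg}(S/I(G))$ holds if and only if $s_i=1$ for all $1\le i\le m$ and $t_j\ge 1$ for all $1\le j\le n$.
   Context: $K$ is a field. For a finite simple graph $G$ on the vertex set $V(G)=\{x_1,\dots,x_n\}$, let $K[V(G)]$ be the polynomial ring over $K$ in the vertices of $G$ as variables, each of degree $1$, and let $I(G)=(x_ix_j : \{x_i,x_j\}\in E(G))\subset K[V(G)]$ be the edge ideal. For a homogeneous ideal $I$ of a standard graded polynomial ring $S$ over $K$ with $d=\dim S/I$ (Krull dimension), the Hilbert series is written $H(S/I,\lambda)=\frac{h_0+h_1\lambda+\cdots+h_s\lambda^s}{(1-\lambda)^d}$ with $h_i\in\mathbb{Z}$ and $h_s\neq 0$; the numerator is the $h$-polynomial $h(S/I,\lambda)$. The regularity is $\operatorname{reg}(S/I)=\max\{j:\beta_{i,i+j}(S/I)\ne 0 \text{ for some } i\}$, where $\beta_{i,i+j}(S/I)$ are the graded Betti numbers. Cameron--Walker graphs: A star graph is a graph obtained by joining some (at least one) paths of length $1$ at one common vertex. A star triangle is a graph obtained by joining some (at least one) triangles at one common vertex. A Cameron--Walker graph is a finite connected simple graph, neither a star graph nor a star triangle, consisting of a connected bipartite graph (the bipartite part) with vertex partition $\{v_1,\dots,v_m\}\cup\{w_1,\dots,w_n\}$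 ($m,n\ge 1$) such that at least one leaf edge is attached to each $v_i$ and possibly some pendant triangles are attached to each $w_j$. Standard labeling: the vertex set is $\{v_1,\dots,v_m\}\cup\{w_1,\dots,w_n\}\cup\bigcup_{i=1}^m\{x^{(i)}_1,\dots,x^{(i)}_{s_i}\}\cup\bigcup_{j=1}^n\bigcup_{\ell=1}^{t_j}\{y^{(j)}_{\ell,1},y^{(j)}_{\ell,2}\}$, with $s_i\ge 1$ and $t_j\ge 0$; the edges are those of the bipartite part, the leaf edges $\{v_i,x^{(i)}_k\}$, and the edges of the pendant triangles $\{w_j,y^{(j)}_{\ell,1},y^{(j)}_{\ell,2}\}$. So $s_i$ is the number of leaf edges attached to $v_i$ and $t_j$ the number of pendant triangles attached to $w_j$. *)

(* Defs.v *)
From mathcomp Require Export all_boot all_order all_algebra.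
From mathcomp.multinomials Require Export mpoly.

Set Implicit Arguments.
Unset Strict Implicit.
Unset Printing Implicit Defensive.

Import GRing.Theory.
Local Open Scope ring_scope.

(* Graphs.  A graph on the vertex type T is its adjacency relation.  Star and *)
(* star-triangle graphs are given by a model on option _, the common vertex   *)
(* being None; the two non-central vertices of the l-th triangle are          *)
(* Some (l, false) and Some (l, true).                                        *)

Definition simple_graph (T : Type) (e : rel T) : Prop :=
  ssrbool.symmetric e /\ irreflexive e.

Definition connected_graph (T : finType) (e : rel T) : Prop :=
  forall x y : T, connect e x y.

Definition graph_iso (T U : Type) (e : rel T) (f : rel U) : Prop :=
  exists2 g : T -> U, bijective g & forall x y, e x y = f (g x) (g y).

Definition star_adj (k : nat) : rel (option 'I_k) :=
  fun x y => match x, y with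
  | None, Some _ | Some _, None => true
  | _, _ => false
  end.

Definition star_triangle_adj (k : nat) : rel (option ('I_k * bool)) :=
  fun x y => match x, y with
  | None, Some _ | Some _, None => true
  | Some (l, b), Some (l', b') => (l == l') && (b != b')
  | None, None => false
  end.

Definition is_star (T : Type) (e : rel T) : Prop :=
  exists2 k : nat, (0 < k)%N & graph_iso e (@star_adj k).

Definition is_star_triangle (T : Type) (e : rel T) : Prop :=
  exists2 k : nat, (0 < k)%N & graph_iso e (@star_triangle_adj k).

(* The labels v_i, w_j, x^(i)_k and y^(j)_(l,1), y^(j)_(l,2), the last two    *)
(* being CWy j l false and CWy j l true.                                      *)
Inductive cw_vertex (m n : nat) (s : 'I_m -> nat) (t : 'I_n -> nat) : Type :=
| CWv of 'I_m
| CWw of 'I_n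
| CWx (i : 'I_m) of 'I_(s i)
| CWy (j : 'I_n) of 'I_(t j) & bool.

Definition cw_adj (m n : nat) (s : 'I_m -> nat) (t : 'I_n -> nat)
    (bip : 'I_m -> 'I_n -> bool) : rel (cw_vertex s t) :=
  fun a b => match a, b with
  | CWv i, CWw j | CWw j, CWv i => bip i j
  | CWv i, CWx i' _ | CWx i' _, CWv i => i == i'
  | CWw j, CWy j' _ _ | CWy j' _ _, CWw j => j == j'
  | CWy j l c, CWy j' l' c' => [&& j == j', l == l' :> nat & c != c']
  | _, _ => false
  end.

Definition bipartite_adj (m n : nat) (bip : 'I_m -> 'I_n -> bool) :
    rel ('I_m + 'I_n)%type :=
  fun a b => match a, b with
  | inl i, inr j | inr j, inl i => bip i j
  | _, _ => false
  end.

(* e is a Cameron-Walker graph on T and lab is a standard labeling of its     *)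
(* vertices, bip being the adjacency between the v_i and the w_j.             *)
Record cameron_walker (T : finType) (e : rel T) (m n : nat)
    (s : 'I_m -> nat) (t : 'I_n -> nat) (bip : 'I_m -> 'I_n -> bool)
    (lab : cw_vertex s t -> T) : Prop := CameronWalker {
  cw_simple : simple_graph e;
  cw_connected : connected_graph e;
  cw_not_star : ~ is_star e;
  cw_not_star_triangle : ~ is_star_triangle e;
  cw_m_gt0 : (0 < m)%N;
  cw_n_gt0 : (0 < n)%N;
  cw_bip_connected : connected_graph (bipartite_adj bip);
  cw_s_gt0 : forall i, (0 < s i)%N;
  cw_lab_bij : bijective lab;
  cw_labE : forall a b, e (lab a) (lab b) = cw_adj bip a b
}.

(* Ideals are Prop-valued: the ideals of ring_quotient are boolean            *)
(* predicates, and the Krull dimension ranges over all prime ideals.          *)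

Definition is_ideal (R : comNzRingType) (I : R -> Prop) : Prop :=
  [/\ I 0, forall x y, I x -> I y -> I (x + y) & forall a x, I x -> I (a * x)].

Definition is_prime_ideal (R : comNzRingType) (P : R -> Prop) : Prop :=
  [/\ is_ideal P, ~ P 1 & forall x y, P (x * y) -> P x \/ P y].

Definition strict_sub (R : Type) (P Q : R -> Prop) : Prop :=
  (forall x, P x -> Q x) /\ exists2 x, Q x & ~ P x.

(* A chain P 0 < ... < P l of primes of R / I, seen as primes of R            *)
(* containing I.                                                              *)
Definition prime_chain (R : comNzRingType) (I : R -> Prop) (l : nat)
    (P : nat -> R -> Prop) : Prop :=
  (forall i, (i <= l)%N -> is_prime_ideal (P i) /\ forall x, I x -> P i x) /\
  (forall i, (i < l)%N -> strict_sub (P i) (P i.+1)).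

(* dim R / I = d *)
Definition krull_dim (R : comNzRingType) (I : R -> Prop) (d : nat) : Prop :=
  (exists P, prime_chain I d P) /\
  (forall l P, prime_chain I l P -> (l <= d)%N).

Section StandardGraded.

Variables (K : fieldType) (N : nat).

Local Notation S := {mpoly K[N]}.

Implicit Type I : S -> Prop.

(* dim_K (S / I)_k = d, for a homogeneous ideal I: some forms b_1, ..., b_d   *)
(* of degree k induce a basis of (S / I)_k.                                   *)
Definition quot_dim I (k d : nat) : Prop :=
  exists b : 'I_d -> S,
  [/\ forall i, b i \is k.-homog,
      forall c : 'I_d -> K, I (\sum_i c i *: b i) -> forall i, c i = 0 &
      forall p : S, p \is k.-homog ->
        exists c : 'I_d -> K, I (p - \sum_i c i *: b i)].

(* h is the h-polynomial of S / I: the k-th coefficient of the power series   *)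
(* H(S / I, X) * (1 - X)^d is h`_k.                                           *)
Definition h_polynomial I (h : {poly int}) : Prop :=
  exists (H : nat -> nat) (d : nat),
  [/\ forall k, quot_dim I k (H k),
      krull_dim I d &
      forall k, h`_k =
        \sum_(i < k.+1) (H i)%:Z * (((1 - 'X) ^+ d : {poly int})`_(k - i))].

(* Augmented complexes ... -> F_1 -> F_0 -> S / I of free modules             *)
(* F_i = \bigoplus_k S(- shift i k), with k < rank i.  Elements of F_i are    *)
(* row vectors, on which diff i : F_(i+1) -> F_i acts by right                *)
(* multiplication; aug lifts the augmentation F_0 -> S / I to S.              *)
Record free_complex : Type := FreeComplex {
  rank : nat -> nat;
  shift : forall i, 'I_(rank i) -> nat;
  diff : forall i, 'M[S]_(rank i.+1, rank i);
  aug : 'cV[S]_(rank 0)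
}.

Record minimal_graded_free_resolution I (F : free_complex) : Prop :=
    MinimalGradedFreeResolution {
  aug_graded : forall j : 'I_(rank F 0), aug F j 0 \is (shift j).-homog;
  (* diff F i j k is homogeneous of degree shift j - shift k, hence 0 if that *)
  (* difference is negative.                                                  *)
  diff_graded : forall i (j : 'I_(rank F i.+1)) (k : 'I_(rank F i)),
    {in msupp (diff F i j k), forall mm, shift j = (shift k + mdeg mm)%N};
  aug_surj : forall p : S,
    exists u : 'rV[S]_(rank F 0), I (p - (u *m aug F) 0 0);
  exact0 : forall u : 'rV[S]_(rank F 0),
    I ((u *m aug F) 0 0) <-> exists v, u = v *m diff F 0;
  exactS : forall i (u : 'rV[S]_(rank F i.+1)),
    u *m diff F i = 0 <-> exists v, u = v *m diff F i.+1;
  diff_minimal : forall i (j : 'I_(rank F i.+1)) (k : 'I_(rank F i)),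
    (diff F i j k)@_0%MM = 0
}.

Definition betti (F : free_complex) (i j : nat) : nat :=
  #|[set k : 'I_(rank F i) | shift k == j]|.

(* reg (S / I) = r *)
Definition regularity I (r : nat) : Prop :=
  exists F : free_complex,
  [/\ minimal_graded_free_resolution I F,
      exists i, betti F i (i + r) <> 0%N &
      forall i j, betti F i (i + j) <> 0%N -> (j <= r)%N].

End StandardGraded.

(* The vertex x is the variable 'X_(enum_rank x) of K[V(G)]. *)
Definition edge_ideal (K : fieldType) (T : finType) (e : rel T)
    (p : {mpoly K[#|T|]}) : Prop :=
  exists c : T -> T -> {mpoly K[#|T|]},
    p = \sum_x \sum_(y | e x y)
          c x y * ('X_(enum_rank x) * 'X_(enum_rank y)).
Arguments edge_ideal K [T] e p.

(* Main.v *)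
Require Import Defs.

Set Implicit Arguments.
Unset Strict Implicit.
Unset Printing Implicit Defensive.

Import GRing.Theory.
Local Open Scope ring_scope.

(** Both invariants have closed forms:
    deg h = sum_i s_i + sum_j max(t_j, 1)  and  reg = m + sum_j t_j.
    Comparing the two sums term by term gives the inequality and the equality
    case.

    Regularity.  The chosen leaf edge at each v_i, together with the edge of each
    pendant triangle that avoids w_j, form an induced matching with
    m + sum_j t_j edges ([cw_adj_end]).  On the other hand the edges of the graph
    split into as many classes, the edges at v_i and the edges of one triangle,
    and any two edges of one class meet ([cw_color_meet]).  The regularity is at
    least the size of an induced matching and at most the number of classes of
    such a partition ([regularity_matching]).  Both bounds are proved for the
    Koszul homology of S/I.  The upper bound is an induction on the vertices,
    through the exact sequence relating I, I : x and I + (x) ([kreg_nonstd]).  For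
    the lower bound, the matching yields a Koszul cycle and a linear form that
    kills the boundaries but not this cycle ([matching_cycle_not_boundary]).
    Koszul homology is related to an arbitrary minimal free resolution by
    chasing through the tensor product of the two complexes, in one direction
    for each bound ([shift_le_kreg], [kreg_shift_le]).

    Degree.  Counting standard monomials by their support F, an independent set,
    writes the Hilbert series as the sum of (X / (1 - X))^|F|.  If d0 is the
    largest size of an independent set, the numerator over (1 - X)^d0 is
    Q = sum_F X^|F| (1 - X)^(d0 - |F|), and Q(1) <> 0.  The Krull dimension is at
    most d0, as more than d0 elements of S are algebraically dependent modulo I,
    whereas a chain of primes provides independent ones ([prime_chain_le]); as
    the h-polynomial is a polynomial, the dimension is then d0 and the
    h-polynomial is Q ([h_poly_supp_poly]).  The coefficient of X^d0 in Q is, up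
    to sign, the value at -1 of the independence polynomial; removing the closed
    neighbourhood of the neighbour of a leaf only changes the sign of this value,
    and these removals, made along the induced matching, exhaust the graph
    ([cw_signed_indep_neq0]).  Hence deg h = d0.  Finally, the vertices are covered
    by the cliques {v_i, x_1}, the {x_k} for k > 1, the first triangle at each w_j
    (or {w_j} if there is none) and the edges avoiding w_j of its other triangles;
    this bounds d0, and one vertex from each clique can be chosen so as to form an
    independent set ([cw_indep_le], [cw_indep_max]). *)

(** * Monomial ideals *)

Section MonomialIdeals.

Variables (K : fieldType) (N : nat).

Local Notation S := {mpoly K[N]}.
Local Notation mon := 'X_{1..N}.

Implicit Types (B : pred mon) (p q : S) (m : mon).

(** Monomial ideals are given by the set of the monomials they contain, closed
    under multiplication; membership is then a condition on coefficients. *)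
Definition mon_up B := forall m m', B m -> B (m + m')%MM.

Definition mon_ideal B p := forall m, p@_m != 0 -> B m.

Definition mfilter B p : S := \sum_(m <- msupp p | B m) p@_m *: 'X_[m].

Lemma mcoeff_mfilter B p m : (mfilter B p)@_m = if B m then p@_m else 0.
Proof.
rewrite /mfilter raddf_sum /=; under eq_bigr do rewrite mcoeffZ mcoeffX.
have [m_p|m_p] := boolP (m \in msupp p); last first.
  rewrite (memN_msupp_eq0 m_p) if_same big1_seq // => m' /andP[_ m'_p].
  by case: eqP => [Em|]; [rewrite -Em m'_p in m_p | rewrite mulr0].
rewrite big_mkcond (bigD1_seq m) //= ?msupp_uniq // eqxx mulr1 big1 ?addr0 //.
by move=> m' /negPf ->; rewrite mulr0 if_same.
Qed.

Lemma mon_ideal0 B : mon_ideal B 0.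
Proof. by move=> m; rewrite mcoeff0 eqxx. Qed.

Lemma mon_idealD B p q : mon_ideal B p -> mon_ideal B q -> mon_ideal B (p + q).
Proof.
move=> Bp Bq m; rewrite mcoeffD; have [->|/Bp//] := eqVneq p@_m 0.
by rewrite add0r; apply: Bq.
Qed.

Lemma mon_idealN B p : mon_ideal B p -> mon_ideal B (- p).
Proof. by move=> Bp m; rewrite mcoeffN oppr_eq0; apply: Bp. Qed.

Lemma mon_idealB B p q : mon_ideal B p -> mon_ideal B q -> mon_ideal B (p - q).
Proof. by move=> Bp Bq; apply/mon_idealD/mon_idealN. Qed.

Lemma mon_ideal_sum B (I : Type) (r : seq I) (P : pred I) (F : I -> S) :
  (forall i, P i -> mon_ideal B (F i)) -> mon_ideal B (\sum_(i <- r | P i) F i).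
Proof.
move=> BF; elim/big_ind: _ => //; [exact: mon_ideal0 | exact: mon_idealD].
Qed.

Lemma mon_idealM B p q : mon_up B -> mon_ideal B q -> mon_ideal B (p * q).
Proof.
move=> upB Bq m; rewrite -mcoeff_msupp => /msuppM_le/allpairsP[[m1 m2] /=].
by case=> _ m2q ->; rewrite addmC; apply/upB/Bq; rewrite -mcoeff_msupp.
Qed.

Lemma mon_idealXM B x p :
  mon_ideal B ('X_x * p) <-> mon_ideal (fun m => B (m + U_(x))%MM) p.
Proof.
split=> Bp m.
  by move=> pm; apply: Bp; rewrite mulrC addmC mcoeffMX.
rewrite -mcoeff_msupp mulrC => /msuppM_le/allpairsP[[m1 m2] /= [m1p]].
by rewrite msuppX inE => /eqP -> ->; apply: Bp; rewrite -mcoeff_msupp.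
Qed.

Lemma mcoeff_XM0 x p : ('X_x * p)@_0%MM = 0.
Proof.
apply/eqP; rewrite mcoeff_eq0; apply/negP; rewrite mulrC.
case/msuppM_le/allpairsP=> [[m1 m2] /= [_]]; rewrite msuppX inE => /eqP ->.
by move/eqP; rewrite eq_sym mnmD_eq0 mnm1_eq0 andbF.
Qed.

Lemma mdivX x p : (forall m, p@_m != 0 -> m x != 0%N) ->
  exists u, p = 'X_x * u.
Proof.
move=> px; exists (\sum_(m <- msupp p) p@_m *: 'X_[m - U_(x)]).
rewrite {1}[p]mpolyE mulr_sumr big_seq [RHS]big_seq.
apply: eq_bigr => m m_p; rewrite -scalerAr -mpolyXD addmC submK //.
by rewrite lep1mP px // -mcoeff_msupp.
Qed.

Lemma dhomog_XM d x p : ('X_x * p \is d.+1.-homog) = (p \is d.-homog).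
Proof.
apply/idP/idP=> /dhomogP hp; last first.
  by rewrite -add1n; apply: dhomogM; [rewrite dhomogX /= mdeg1 | apply/dhomogP].
apply/dhomogP=> m m_p; have /hp : (m + U_(x))%MM \in msupp ('X_x * p).
  by rewrite mcoeff_msupp mulrC addmC mcoeffMX -mcoeff_msupp.
by rewrite /= mdegD mdeg1 addn1 => -[].
Qed.

Lemma dhomog_mfilter d B p : p \is d.-homog -> mfilter B p \is d.-homog.
Proof.
move/dhomogP=> hp; apply/dhomogP=> m; rewrite mcoeff_msupp mcoeff_mfilter.
by case: ifP => _; rewrite ?eqxx // -mcoeff_msupp => /hp.
Qed.

Lemma mfilter_split B p : p = mfilter B p + mfilter (predC B) p.
Proof.
apply/mpolyP=> m; rewrite mcoeffD !mcoeff_mfilter /=.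
by case: (B m); rewrite (addr0, add0r).
Qed.

Lemma mon_ideal_mfilter B p : mon_ideal B (mfilter B p).
Proof. by move=> m; rewrite mcoeff_mfilter; case: ifP; rewrite ?eqxx. Qed.

End MonomialIdeals.

(** * The Koszul complex *)

(** The monomial basis of an exterior algebra on [N] generators, so that Koszul
    chains are columns and the differential is a square matrix that commutes with
    the maps of a resolution, acting on the other side.  The order [eb_pos] of
    the generators, which determines the signs, is a parameter: a matching is
    easiest to handle when the two ends of each edge are consecutive. *)
Record exterior_basis (N : nat) := ExteriorBasis {
  eb_size : nat;
  eb_index : {set 'I_N} -> 'I_eb_size;
  eb_set : 'I_eb_size -> {set 'I_N};
  eb_indexK : cancel eb_index eb_set;
  eb_setK : cancel eb_set eb_index;
  eb_pos : 'I_N -> nat;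
  eb_pos_inj : injective eb_pos
}.

Section Koszul.

Variables (R : comNzRingType) (N : nat) (E : exterior_basis N) (a : 'I_N -> R).

Local Notation L := (eb_size E).
Local Notation rk := (@eb_index N E).
Local Notation sg := (@eb_set N E).
Local Notation f := (@eb_pos N E).

Implicit Types (s : {set 'I_N}) (k l x : 'I_N).

Definition kpos s k := #|[set i in s | (f i < f k)%N]|.

Lemma kposU s k l : l \notin s -> kpos (l |: s) k = ((f l < f k) + kpos s k)%N.
Proof.
move=> ls; rewrite /kpos; case: ltnP => lk.
  rewrite (_ : [set i in l |: s | _] = l |: [set i in s | (f i < f k)%N]).
    by rewrite cardsU1 inE (negPf ls).
  by apply/setP=> i; rewrite !inE; case: eqP => // ->; rewrite lk.
rewrite add0n; apply: eq_card => i; rewrite !inE.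
by case: eqP => // ->; rewrite (negPf ls) ltnNge lk.
Qed.

(** Interior and exterior product with a generator: up to sign, they add [k] to,
    resp. remove [k] from, the index, since matrices act on coordinates. *)
Definition kcontr k : 'M[R]_L := \matrix_(i < L)
  (if k \in sg i then 0
   else (-1) ^+ kpos (sg i) k *: delta_mx 0 (rk (k |: sg i))).

Definition kwedge k : 'M[R]_L := \matrix_(i < L)
  (if k \in sg i then
     (-1) ^+ kpos (sg i) k *: delta_mx 0 (rk (sg i :\ k))
   else 0).

Lemma kcontrE n k s (Z : 'M[R]_(L, n)) j :
  (kcontr k *m Z) (rk s) j =
  if k \in s then 0 else (-1) ^+ kpos s k * Z (rk (k |: s)) j.
Proof.
transitivity ((row (rk s) (kcontr k) *m Z) 0 j); first by rewrite -row_mul [RHS]mxE.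
rewrite rowK eb_indexK; case: ifP => _; first by rewrite mul0mx mxE.
by rewrite -scalemxAl -rowE !mxE.
Qed.

Lemma kwedgeE n k s (Z : 'M[R]_(L, n)) j :
  (kwedge k *m Z) (rk s) j =
  if k \in s then (-1) ^+ kpos s k * Z (rk (s :\ k)) j else 0.
Proof.
transitivity ((row (rk s) (kwedge k) *m Z) 0 j); first by rewrite -row_mul [RHS]mxE.
rewrite rowK eb_indexK; case: ifP => _; last by rewrite mul0mx mxE.
by rewrite -scalemxAl -rowE !mxE.
Qed.

Lemma matrix_setP n (Z Z' : 'M[R]_(L, n)) :
  (forall s j, Z (rk s) j = Z' (rk s) j) -> Z = Z'.
Proof. by move=> eqZ; apply/matrixP=> i j; rewrite -(eb_setK i) eqZ. Qed.

Lemma ltn_add_inj k l : k != l -> ((f k < f l) + (f l < f k) = 1)%N.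
Proof. by move=> kl; case: ltngtP => // /eb_pos_inj/eqP; rewrite (negPf kl). Qed.

Lemma kcontrC n k l (Z : 'M[R]_(L, n)) :
  kcontr k *m (kcontr l *m Z) = - (kcontr l *m (kcontr k *m Z)).
Proof.
apply: matrix_setP => s j; rewrite [RHS]mxE !kcontrE !in_setU1.
have [->|kl] := eqVneq k l; first by rewrite /= mulr0 if_same oppr0.
rewrite /=.
have [ks|ks] := boolP (k \in s); have [ls|ls] := boolP (l \in s);
  rewrite ?mulr0 ?oppr0 // !mulrA -!exprD !kposU // -mulNr setUCA.
congr (_ * _); have := ltn_add_inj kl.
case: (f k < f l)%N; case: (f l < f k)%N => // _.
  by rewrite add1n add0n addnS exprS mulN1r addnC.
by rewrite add0n add1n addnS [in RHS]exprS mulN1r opprK addnC.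
Qed.

Lemma kcontr_sq n k (Z : 'M[R]_(L, n)) : kcontr k *m (kcontr k *m Z) = 0.
Proof.
apply: matrix_setP => s j.
by rewrite [RHS]mxE !kcontrE in_setU1 eqxx mulr0 if_same.
Qed.

(** The Clifford relation. *)
Lemma kcontr_wedge n k x (Z : 'M[R]_(L, n)) :
  kcontr k *m (kwedge x *m Z) + kwedge x *m (kcontr k *m Z) =
  if k == x then Z else 0.
Proof.
have sgn_sq c : (-1) ^+ c * (-1) ^+ c = 1 :> R.
  by rewrite -exprD addnn -mul2n exprM sqrrN !expr1n.
apply: matrix_setP => s j; rewrite [LHS]mxE kcontrE !kwedgeE kcontrE.
rewrite in_setU1 in_setD1; have [->|kx] := eqVneq k x.
  rewrite /=; have [xs|xs] := boolP (x \in s).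
    rewrite add0r mulrA setD1K // -{1}(setD1K xs) kposU ?setD11 //.
    by rewrite ltnn add0n sgn_sq mul1r.
  by rewrite addr0 mulrA setU1K // kposU // ltnn add0n sgn_sq mul1r.
rewrite [RHS]mxE /=.
have [ks|ks] := boolP (k \in s); have [xs|xs] := boolP (x \in s);
  rewrite ?mulr0 ?addr0 //.
have -> : (k |: s) :\ x = k |: s :\ x.
  by apply/setP=> i; rewrite !inE; case: (eqVneq i k) => // ->; rewrite kx.
have -> : kpos s x = kpos (s :\ x) x.
  by rewrite -{1}(setD1K xs) kposU ?setD11 // ltnn.
have -> : kpos s k = ((f x < f k) + kpos (s :\ x) k)%N.
  by rewrite -{1}(setD1K xs) kposU ?setD11.
have -> : kpos (k |: s) x = ((f k < f x) + kpos (s :\ x) x)%N.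
  by rewrite kposU // -{1}(setD1K xs) kposU ?setD11 // ltnn.
rewrite !mulrA -mulrDl -!exprD.
rewrite -[in RHS](mul0r (Z (rk (k |: s :\ x)) j)); congr (_ * _).
rewrite addnACA [((f x < _) + _)%N]addnC (ltn_add_inj kx) add1n exprS mulN1r.
by rewrite addnC addNr.
Qed.


Definition kdiff : 'M[R]_L := \sum_k a k *: kcontr k.

Lemma kdiffE n (Z : 'M[R]_(L, n)) : kdiff *m Z = \sum_k a k *: (kcontr k *m Z).
Proof.
by rewrite mulmx_suml; apply: eq_bigr => k _; rewrite -scalemxAl.
Qed.

Lemma kdiff_entry n (Z : 'M[R]_(L, n)) s j :
  (kdiff *m Z) (rk s) j =
  \sum_(k | k \notin s) (-1) ^+ kpos s k * a k * Z (rk (k |: s)) j.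
Proof.
rewrite kdiffE summxE [RHS]big_mkcond; apply: eq_bigr => k _.
by rewrite mxE kcontrE if_neg; case: ifP; rewrite ?mulr0 // mulrCA mulrA.
Qed.

Lemma sum_antisym (V : zmodType) (I : finType) (F : I -> I -> V) :
  (forall i, F i i = 0) -> (forall i j, F i j = - F j i) ->
  \sum_i \sum_j F i j = 0.
Proof.
move=> F0 FN.
rewrite (eq_bigr (fun i => \sum_(j | (enum_rank j < enum_rank i)%N) F i j
   + \sum_(j | (enum_rank i < enum_rank j)%N) F i j)); last first.
  move=> i _; rewrite (bigID (fun j => (enum_rank j < enum_rank i)%N)) /=.
  congr (_ + _); rewrite (bigID (pred1 i)) /=.
  rewrite big1 ?add0r; last by move=> j /andP[_ /eqP->].
  apply: eq_bigl => j; rewrite -leqNgt ltn_neqAle andbC eq_sym.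
  by rewrite (inj_eq val_inj) (inj_eq enum_rank_inj).
rewrite big_split /= (exchange_big_dep predT) //= -big_split /= big1 // => i _.
by rewrite -big_split big1 // => j _; rewrite /= (FN j) addNr.
Qed.

Lemma kdiff_sq n (Z : 'M[R]_(L, n)) : kdiff *m (kdiff *m Z) = 0.
Proof.
rewrite kdiffE; pose F k l := (a k * a l) *: (kcontr k *m (kcontr l *m Z)).
rewrite (eq_bigr (fun k => \sum_l F k l)) => [|k _].
  apply: sum_antisym => [k|k l]; rewrite /F ?kcontr_sq ?scaler0 //.
  by rewrite kcontrC scalerN mulrC.
rewrite kdiffE mulmx_sumr scaler_sumr; apply: eq_bigr => l _.
by rewrite -scalemxAr scalerA.
Qed.

(** Wedging with a generator is a homotopy from multiplication by the
    corresponding element to zero: every element of the sequence kills the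
    homology. *)
Lemma kdiff_homotopy n x (Z : 'M[R]_(L, n)) :
  a x *: Z = kdiff *m (kwedge x *m Z) + kwedge x *m (kdiff *m Z).
Proof.
rewrite !kdiffE mulmx_sumr -big_split /= (bigD1 x) //= big1 ?addr0 => [|k kx].
  by rewrite -scalemxAr -scalerDr kcontr_wedge eqxx.
by rewrite -scalemxAr -scalerDr kcontr_wedge (negPf kx) scaler0.
Qed.

End Koszul.

(** * Transferring exactness through a double complex *)

Section DoubleComplex.

Variables (R : comNzRingType) (L : nat) (rank : nat -> nat).
Variables (D : 'M[R]_L) (diff : forall p, 'M[R]_(rank p.+1, rank p)).
Variable gr : forall p, 'M[R]_(L, rank p) -> Prop.
Hypothesis DD0 : forall n (Z : 'M[R]_(L, n)), D *m (D *m Z) = 0.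
Hypothesis dd0 : forall p, diff p.+1 *m diff p = 0.
Hypothesis diff_exact : forall p (Z : 'M[R]_(L, rank p.+1)),
  Z *m diff p = 0 -> exists V, Z = V *m diff p.+1.

(** The rows of the double complex are resolved by [diff], its columns are the
    complex [D], exact away from the edges.  A cycle in row [p] is pushed
    down to row 0, where it is a boundary by assumption, and the boundary is
    pulled back up. *)
Lemma double_complex_down :
  (forall p (Z : 'M[R]_(L, rank p.+1)), gr Z -> D *m (Z *m diff p) = 0 ->
     exists2 Z1, gr Z1 & Z *m diff p = D *m Z1) ->
  (forall (Z : 'M[R]_(L, rank 0)) Z', gr Z -> D *m Z = Z' *m diff 0 ->
     exists W V, Z = D *m W + V *m diff 0) ->
  forall p (Z : 'M[R]_(L, rank p)) Z', gr Z -> D *m Z = Z' *m diff p ->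
    exists W V, Z = D *m W + V *m diff p.
Proof.
move=> D_exact row0; elim=> [|p IHp] Z Z' grZ DZ; first exact: row0 DZ.
have [|Z1 grZ1 Zd] := D_exact p Z grZ.
  by rewrite mulmxA DZ -mulmxA dd0 mulmx0.
have [W [V Z1E]] := IHp Z1 Z grZ1 (esym Zd).
have [|V' ZE] := @diff_exact p (Z - D *m V).
  by rewrite mulmxBl Zd Z1E mulmxDr DD0 add0r mulmxA subrr.
by exists V, V'; rewrite -ZE addrC subrK.
Qed.

(** The chase in the other direction ends because [sp c] bounds the length of what
    remains of the complex [D]. *)
Lemma double_complex_up (gr' : forall p, 'M[R]_(L, rank p) -> Prop)
    (sp : nat -> forall p, 'M[R]_(L, rank p) -> Prop) :
  (forall p, gr' p 0) ->
  (forall p (Z : 'M[R]_(L, rank p)), sp 0%N p Z -> Z = 0) ->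
  (forall c p (Z : 'M[R]_(L, rank p)) V, gr Z -> sp c.+1 p Z ->
     D *m Z = V *m diff p ->
     exists Z', [/\ gr Z', sp c p.+1 Z' & D *m Z = Z' *m diff p]) ->
  (forall p (Z : 'M[R]_(L, rank p)) V, gr Z -> gr' p.+1 V ->
     D *m (Z - V *m diff p) = 0 ->
     exists2 W, gr' p W & Z - V *m diff p = D *m W) ->
  forall c p (Z : 'M[R]_(L, rank p)) V, sp c p Z -> gr Z ->
    D *m Z = V *m diff p ->
    exists W V', gr' p W /\ Z = D *m W + V' *m diff p.
Proof.
move=> gr'0 sp0 lift D_exact; elim=> [|c IHc] p Z V spZ grZ DZ.
  by exists 0, 0; rewrite !(mulmx0, mul0mx) addr0; split=> //; apply: sp0.
have [Z' [grZ' spZ' DZ']] := lift c p Z V grZ spZ DZ.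
have [|V1 DZ'E] := @diff_exact p (D *m Z').
  by rewrite -mulmxA -DZ' DD0.
have [W' [V' [grW' Z'E]]] := IHc _ Z' V1 spZ' grZ' DZ'E.
have [||W grW ZE] := D_exact p Z W' grZ => //.
  by rewrite mulmxBr DZ' Z'E mulmxDl -(mulmxA V') dd0 mulmx0 addr0 mulmxA subrr.
by exists W, W'; split=> //; rewrite -ZE subrK.
Qed.

End DoubleComplex.

(** * Koszul regularity of monomial ideals *)

Section KoszulRegularity.

Variables (K : fieldType) (N : nat) (E : exterior_basis N).

Local Notation S := {mpoly K[N]}.
Local Notation mon := 'X_{1..N}.
Local Notation L := (eb_size E).
Local Notation D := (kdiff E (fun k => 'X_k : S)).

Implicit Types (B : pred mon) (z w y u : 'cV[S]_L).

Definition in_mon_cv B z := forall i, mon_ideal B (z i 0).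
Definition homog_cv d z := forall i, z i 0 \is d.-homog.

Lemma in_mon_cvD B z w : in_mon_cv B z -> in_mon_cv B w -> in_mon_cv B (z + w).
Proof. by move=> Bz Bw i; rewrite mxE; apply: mon_idealD. Qed.

Lemma in_mon_cvB B z w : in_mon_cv B z -> in_mon_cv B w -> in_mon_cv B (z - w).
Proof. by move=> Bz Bw i; rewrite !mxE; apply: mon_idealB. Qed.

Lemma in_mon_cvM B n (A : 'M[S]_(n, L)) z (i : 'I_n) : mon_up B ->
  in_mon_cv B z -> mon_ideal B ((A *m z) i 0).
Proof.
by move=> upB Bz; rewrite mxE; apply: mon_ideal_sum => k _; apply: mon_idealM.
Qed.

Lemma in_mon_cvX B x z :
  in_mon_cv B ('X_x *: z) <-> in_mon_cv (fun m => B (m + U_(x))%MM) z.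
Proof.
have zE i : ('X_x *: z) i 0 = 'X_x * z i 0 by rewrite mxE.
by split=> Bz i; have := Bz i; rewrite zE mon_idealXM.
Qed.

Lemma homog_cvD d z w : homog_cv d z -> homog_cv d w -> homog_cv d (z + w).
Proof. by move=> hz hw i; rewrite mxE rpredD. Qed.

Lemma homog_cvB d z w : homog_cv d z -> homog_cv d w -> homog_cv d (z - w).
Proof. by move=> hz hw i; rewrite !mxE rpredB. Qed.

Lemma dhomog_sgn d c (p : S) : p \is d.-homog -> (-1) ^+ c * p \is d.-homog.
Proof. by move=> hp; rewrite -signr_odd mulr_sign; case: ifP => _; rewrite ?rpredN. Qed.

Lemma homog_cv_diff d z : homog_cv d z -> homog_cv d.+1 (D *m z).
Proof.
move=> hz i; rewrite -(eb_setK i) kdiff_entry; apply: rpred_sum => k _.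
by rewrite -mulrA; apply: dhomog_sgn; rewrite dhomog_XM.
Qed.

Lemma homog_cv_wedge d x z : homog_cv d z -> homog_cv d (kwedge S E x *m z).
Proof.
move=> hz i; rewrite -(eb_setK i) kwedgeE; case: ifP => _; last exact: rpred0.
exact: dhomog_sgn.
Qed.

(** Regularity at most [r], measured by Koszul homology: [H_i] vanishes in degree
    [i + j] for [j > r].  As the generators of the exterior algebra have degree
    1, only the degree [j] of the coefficients matters, and all homological
    degrees [i] can be treated at once. *)
Definition kreg B r := forall j z, (r <= j)%N -> homog_cv j.+1 z ->
  in_mon_cv B (D *m z) ->
  exists2 w, homog_cv j w & in_mon_cv B (z - D *m w).

Lemma kregW B r r' : (r <= r')%N -> kreg B r -> kreg B r'.
Proof. by move=> rr' Br j z /(leq_trans rr'); apply: Br. Qed.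

Lemma eq_kreg B B' r : B =1 B' -> kreg B r -> kreg B' r.
Proof.
move=> eqB; have eqI z : in_mon_cv B z <-> in_mon_cv B' z.
  by split=> Bz i m /Bz; rewrite eqB.
by move=> Br j z rj hz /eqI/(Br _ _ rj hz)[w hw /eqI ?]; exists w.
Qed.

Lemma in_mon_cv_split B x d y :
  in_mon_cv (fun m => B m || (m x != 0%N)) y -> homog_cv d.+1 y ->
  exists y1 u, [/\ y = y1 + 'X_x *: u, in_mon_cv B y1 & homog_cv d u].
Proof.
move=> By hy; pose y2 i := mfilter (predC B) (y i 0).
have /(_ _)/mdivX y2x i m : (y2 i)@_m != 0 -> m x != 0%N.
  rewrite mcoeff_mfilter /=; case: ifP => [/negPf BmF|]; last by rewrite eqxx.
  by move/(By i); rewrite BmF.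
have [u uE] : exists u : 'cV[S]_L, forall i, y2 i = 'X_x * u i 0.
  have [u uE] : exists u : 'I_L -> S, forall i, y2 i = 'X_x * u i.
    by apply: (@fin_all_exists _ (fun=> S) (fun i v => y2 i = 'X_x * v)) => i;
      apply: y2x.
  by exists (\col_i u i) => i; rewrite mxE.
exists (\col_i mfilter B (y i 0)), u; split.
- by apply/matrixP=> i j; rewrite !mxE ord1 {1}(mfilter_split B (y i 0)) -/(y2 i) uE.
- by move=> i; rewrite mxE; apply: mon_ideal_mfilter.
by move=> i; rewrite -(dhomog_XM _ x) -uE /y2; apply: dhomog_mfilter.
Qed.

(** Modulo a boundary, a cycle of [S / B] that bounds in [S / (B + (x))] is
    [x] times a cycle of [S / (B : x)]. *)
Lemma kreg_reduce B x r j z : mon_up B ->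
  kreg (fun m => B m || (m x != 0%N)) r -> (r <= j)%N ->
  homog_cv j.+1 z -> in_mon_cv B (D *m z) ->
  exists w y u, [/\ z - D *m w = y + 'X_x *: u, homog_cv j w, homog_cv j u,
    in_mon_cv B y & in_mon_cv (fun m => B (m + U_(x))%MM) (D *m u)].
Proof.
move=> upB Bxr rj hz BDz.
have [|w hw Bw] := Bxr j z rj hz; first by move=> i m /BDz ->.
have hy : homog_cv j.+1 (z - D *m w) by apply/homog_cvB/homog_cv_diff.
have [y [u [yE By hu]]] := in_mon_cv_split Bw hy.
exists w, y, u; split=> //; apply/in_mon_cvX.
have -> : 'X_x *: (D *m u) = D *m z - D *m y.
  have := congr1 (mulmx D) yE.
  rewrite mulmxBr kdiff_sq subr0 mulmxDr -scalemxAr => ->.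
  by rewrite addrC addrA addNr add0r.
by apply: in_mon_cvB => // i; apply: in_mon_cvM.
Qed.

(** When [x] is regular modulo [B], multiplication by [x] kills the homology, so
    passing to [B + (x)] loses nothing. *)
Lemma kreg_regular B x r : mon_up B ->
  (forall m, B (m + U_(x))%MM -> B m) ->
  kreg (fun m => B m || (m x != 0%N)) r -> kreg B r.
Proof.
move=> upB Bx Bxr j z rj hz BDz.
have [w [y [u [zE hw hu By BDu]]]] := kreg_reduce upB Bxr rj hz BDz.
exists (w + kwedge S E x *m u); first exact/homog_cvD/homog_cv_wedge.
rewrite mulmxDr opprD addrA zE (kdiff_homotopy (fun k => 'X_k : S) x u).
rewrite addrA addrAC addrK; apply: in_mon_cvD => // i; apply: in_mon_cvM => //.
by move=> k m /BDu/Bx.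
Qed.

(** The exact sequence of the homology of [S / (B : x)], shifted by one degree,
    of [S / B] and of [S / (B + (x))], in the middle term. *)
Lemma kreg_colon B x r : mon_up B ->
  kreg (fun m => B (m + U_(x))%MM) r ->
  kreg (fun m => B m || (m x != 0%N)) r.+1 -> kreg B r.+1.
Proof.
move=> upB Br Bxr [|j] z // rj hz BDz.
have [w [y [u [zE hw hu By BDu]]]] := kreg_reduce upB Bxr rj hz BDz.
have [w' hw' Bw'] := Br j u rj hu BDu.
exists (w + 'X_x *: w').
  by apply: homog_cvD => // i; rewrite mxE dhomog_XM.
rewrite mulmxDr opprD addrA zE -scalemxAr -addrA -scalerBr.
by apply: in_mon_cvD => //; apply/in_mon_cvX.
Qed.

End KoszulRegularity.

(** * Independent sets and edge ideals *)

Section Independent.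

Variables (V : finType) (g : rel V).

Implicit Types (F A : {set V}) (x : V).

Definition indep F := [forall i in F, forall j in F, ~~ g i j].

Definition nbhd x := x |: [set y | g x y].

Lemma indepP F : reflect {in F &, forall i j, ~~ g i j} (indep F).
Proof.
apply: (iffP forall_inP) => [iF i j Fi Fj|iF i Fi].
  by have /forall_inP := iF i Fi; apply.
by apply/forall_inP=> j; apply: iF.
Qed.

Lemma indepS F F' : F' \subset F -> indep F -> indep F'.
Proof.
by move=> /subsetP sF /indepP iF; apply/indepP=> i j /sF Fi /sF; apply: iF.
Qed.

Lemma indep0 : indep set0.
Proof. by apply/indepP=> i j; rewrite inE. Qed.

Hypotheses (g_sym : ssrbool.symmetric g) (g_irr : irreflexive g).

Lemma indepU1 x F : indep (x |: F) = indep F && [disjoint F & [set y | g x y]].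
Proof.
apply/indepP/andP=> [iF|[/indepP iF dF] i j].
  split; first by apply/indepP=> i j Fi Fj; apply: iF; rewrite setU1r.
  apply/pred0P=> y; rewrite /= inE; apply/negbTE/nandP.
  by case: (boolP (y \in F)) => [Fy|]; [right; apply: iF; rewrite ?setU11 ?setU1r | left].
have gx y : y \in F -> ~~ g x y by move/(disjointFr dF); rewrite inE => ->.
case/setU1P=> [->|Fi] /setU1P[->|Fj]; rewrite ?g_irr ?gx //; last exact: iF.
by rewrite g_sym gx.
Qed.

End Independent.

Section StandardMonomials.

Variables (N : nat) (g : rel 'I_N).

Local Notation mon := 'X_{1..N}.

Implicit Types (A : {set 'I_N}) (m : mon) (x : 'I_N).

Definition mnm_supp m : {set 'I_N} := [set i | m i != 0%N].

(** The monomials of [I(G[A])] plus all the variables outside [A]: the quotient is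
    that of the edge ideal of the induced subgraph on [A], but over the same
    polynomial ring, so that vertices can be deleted without changing rings. *)
Definition nonstd A : pred mon :=
  fun m => ~~ ((mnm_supp m \subset A) && indep g (mnm_supp m)).

Lemma mnm_suppD m m' : mnm_supp (m + m')%MM = mnm_supp m :|: mnm_supp m'.
Proof. by apply/setP=> i; rewrite !inE mnmDE addn_eq0 negb_and. Qed.

Lemma mnm_suppU x : mnm_supp U_(x)%MM = [set x].
Proof. by apply/setP=> i; rewrite !inE mnm1E eqb0 negbK eq_sym. Qed.

Lemma mnm_supp_eq0 m : (mnm_supp m == set0) = (m == 0%MM).
Proof.
apply/eqP/eqP=> [m0|->]; last by apply/setP=> i; rewrite !inE mnm0E.
apply/mnmP=> i; rewrite mnm0E; apply/eqP.
by move/setP/(_ i): m0; rewrite !inE => /negbFE.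
Qed.

Lemma nonstd_up A : mon_up (nonstd A).
Proof.
move=> m m'; apply: contra => /andP[sA iF].
have sm : mnm_supp m \subset mnm_supp (m + m')%MM.
  by rewrite mnm_suppD subsetUl.
by rewrite (subset_trans sm) // (indepS sm).
Qed.

Lemma nonstdD1 A x m : nonstd A m || (m x != 0%N) = nonstd (A :\ x) m.
Proof.
rewrite /nonstd subsetD1 inE.
by case: (_ \subset _); case: (indep _ _); case: (m x == 0%N).
Qed.

Hypotheses (g_sym : ssrbool.symmetric g) (g_irr : irreflexive g).

(** [(I_A : x) + (x)] is the ideal of the graph without the closed neighbourhood
    of [x]. *)
Lemma nonstd_colon A x m : x \in A ->
  nonstd A (m + U_(x))%MM || (m x != 0%N) = nonstd (A :\: nbhd g x) m.
Proof.
move=> Ax; rewrite /nonstd mnm_suppD mnm_suppU setUC subUset sub1set Ax /=.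
rewrite indepU1 // subsetD; set F := mnm_supp m.
have -> : (m x != 0%N) = (x \in F) by rewrite inE.
have -> : [disjoint F & nbhd g x] = (x \notin F) && [disjoint F & [set y | g x y]].
  rewrite /nbhd; apply/idP/andP.
    move=> dF; split; last by apply: disjointWr dF; apply: subsetUr.
    by apply/negP=> /(disjointFr dF); rewrite setU11.
  case=> xF dF; apply/pred0P=> y; rewrite /= in_setU1 [in X in _ && X]inE.
  case: eqP => [->|_]; first by rewrite (negPf xF).
  by have /pred0P/(_ y) := dF; rewrite /= [in X in _ && X]inE.
by case: (F \subset A); case: (indep g F); case: (x \in F); case: [disjoint F & _].
Qed.

Lemma nonstd_isolated A x m : (forall y, y \in A -> ~~ g x y) -> x \in A ->
  nonstd A (m + U_(x))%MM -> nonstd A m.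
Proof.
move=> gx Ax; apply: contra => /andP[sA iF].
rewrite mnm_suppD mnm_suppU setUC subUset sub1set Ax sA indepU1 // iF /=.
apply/pred0P=> y; rewrite /= [in X in _ && X]inE; apply/negbTE/nandP.
have [Fy|] := boolP (y \in mnm_supp m); last by left.
by right; apply/gx/(subsetP sA).
Qed.

Variables (C : finType) (col : 'I_N -> 'I_N -> C).
Hypothesis col_inter : forall i j k l, g i j -> g k l -> col i j = col k l ->
  (k \in [set i; j]) || (l \in [set i; j]).

Definition edge_colors A : {set C} :=
  [set c | [exists i in A, exists j in A, g i j && (col i j == c)]].

Lemma edge_colorsP A c :
  reflect (exists i j, [/\ i \in A, j \in A, g i j & col i j = c])
    (c \in edge_colors A).
Proof.
rewrite inE; apply: (iffP exists_inP) => [[i Ai /exists_inP[j Aj]]|[i [j]]].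
  by case/andP=> gij /eqP; exists i, j.
case=> Ai Aj gij cE; exists i => //; apply/exists_inP; exists j => //.
by rewrite gij cE eqxx.
Qed.

Lemma edge_colorsS A A' : A \subset A' -> edge_colors A \subset edge_colors A'.
Proof.
move=> /subsetP sA; apply/subsetP=> c /edge_colorsP[i [j [/sA Ai /sA Aj gij cE]]].
by apply/edge_colorsP; exists i, j.
Qed.

(** Regularity is at most the number of colours.  Deleting [x] creates no colour,
    and deleting the closed neighbourhood of [x] loses the colour of any edge at
    [x], since the other edges of that colour meet it; this pays for the shift by
    one in [kreg_colon]. *)
Lemma kreg_nonstd (K : fieldType) (E : exterior_basis N) A :
  kreg K E (nonstd A) #|edge_colors A|.
Proof.
move: {2}#|A| (leqnn #|A|) => n; elim: n A => [|n IHn] A.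
  rewrite leqn0 cards_eq0 => /eqP -> j z _ hz _.
  exists 0 => [i|i m]; first by rewrite mxE rpred0.
  rewrite mulmx0 subr0 -mcoeff_msupp => m_z; rewrite /nonstd subset0.
  rewrite mnm_supp_eq0 -mdeg_eq0.
  by have /dhomogP/(_ m m_z) /= -> := hz i.
move=> leA; have [A0|[x Ax]] := set_0Vmem A; first by apply: IHn; rewrite A0 cards0.
have ltD1 : (#|A :\ x| <= n)%N by move: leA; rewrite (cardsD1 x A) Ax.
have D1 : kreg K E (fun m => nonstd A m || (m x != 0%N)) #|edge_colors A|.
  apply: eq_kreg (fsym (nonstdD1 A x)) _.
  exact: kregW (subset_leq_card (edge_colorsS (subD1set A x))) (IHn _ ltD1).
have [/exists_inP[y Ay gxy]|] := boolP [exists y in A, g x y]; last first.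
  move=> /exists_inPn gx; apply: (kreg_regular (x := x)) => //; first exact: nonstd_up.
  by move=> m; apply: nonstd_isolated.
have cxy : col x y \in edge_colors A by apply/edge_colorsP; exists x, y.
have sD : A :\: nbhd g x \subset A :\ x.
  by rewrite /nbhd; apply: setDS; apply: subsetUl.
have leD : (#|A :\: nbhd g x| <= n)%N by rewrite (leq_trans (subset_leq_card sD)).
have ltc : (#|edge_colors (A :\: nbhd g x)| < #|edge_colors A|)%N.
  rewrite [X in (_ < X)%N](cardsD1 (col x y)) cxy; apply/subset_leq_card/subsetP=> c.
  move=> cD; rewrite in_setD1 (subsetP (edge_colorsS (subsetDl _ _)) c cD) andbT.
  case/edge_colorsP: cD => i [j [Di Dj gij <-]]; apply: contraTneq gxy => cE.
  apply/negP=> gxy; have := col_inter gxy gij (esym cE).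
  move: Di Dj; rewrite !inE !negb_or => /andP[/andP[/negPf-> Ni] _].
  move=> /andP[/andP[/negPf-> Nj] _] /=.
  by case/orP=> /eqP EE; rewrite EE gxy in Ni Nj.
case Ec: #|edge_colors A| ltc => [//|c] ltc; rewrite Ec in D1.
apply: (kreg_colon (x := x)) D1; first exact: nonstd_up.
rewrite ltnS in ltc; apply: (kregW ltc); apply: (kreg_regular (x := x)).
- by move=> m m'; rewrite -addmA [(m' + _)%MM]addmC addmA; apply: nonstd_up.
- move=> m; rewrite /nonstd !mnm_suppD.
  by rewrite -setUA setUid.
by apply: eq_kreg (IHn _ leD) => m; rewrite nonstd_colon.
Qed.

End StandardMonomials.

(** * Koszul homology and the degrees in a minimal resolution *)

Section Graded.

Variables (K : fieldType) (N : nat).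

Local Notation S := {mpoly K[N]}.
Local Notation mon := 'X_{1..N}.

(** [mgr d c p]: [p] is homogeneous of degree [d - c]; it vanishes if [d < c]. *)
Definition mgr (d c : nat) (p : S) := forall m, p@_m != 0 -> d = (c + mdeg m)%N.

Lemma mgr_ideal d c p :
  mgr d c p <-> mon_ideal (fun m => d == (c + mdeg m)%N) p.
Proof. by split=> h m /h => [->|/eqP]. Qed.

Lemma mgr_sum d c (I : Type) (r : seq I) (P : pred I) (F : I -> S) :
  (forall i, P i -> mgr d c (F i)) -> mgr d c (\sum_(i <- r | P i) F i).
Proof. by move=> gF; apply/mgr_ideal/mon_ideal_sum => i /gF/mgr_ideal. Qed.

Lemma mgrB d c p q : mgr d c p -> mgr d c q -> mgr d c (p - q).
Proof. by move=> /mgr_ideal gp /mgr_ideal gq; apply/mgr_ideal/mon_idealB. Qed.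

Lemma mgrM d c c' p q : mgr d c p -> mgr c c' q -> mgr d c' (p * q).
Proof.
move=> gp gq m; rewrite -mcoeff_msupp => /msuppM_le/allpairsP[[m1 m2] /= [m1p m2q ->]].
rewrite mcoeff_msupp in m1p; rewrite mcoeff_msupp in m2q.
by rewrite mdegD (gp _ m1p) (gq _ m2q) -addnA [(mdeg m2 + _)%N]addnC.
Qed.

Lemma mgr_homog d c p : (c <= d)%N -> mgr d c p <-> p \is (d - c).-homog.
Proof.
move=> cd; split=> [gp|/dhomogP hp m].
  by apply/dhomogP=> m; rewrite mcoeff_msupp => /gp ->; rewrite addKn.
by rewrite -mcoeff_msupp => /hp /= ->; rewrite subnKC.
Qed.

Lemma mgr_gt d c p : (d < c)%N -> mgr d c p -> p = 0.
Proof.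
move=> dc gp; apply/mpolyP=> m; rewrite mcoeff0; apply/eqP/negP=> /negP/gp dE.
by move: dc; rewrite dE ltnNge leq_addr.
Qed.

Lemma mgr_eq0 d p : mgr d d p -> p@_0%MM = 0 -> p = 0.
Proof.
move=> gp p0; apply/mpolyP=> m; rewrite mcoeff0; apply/eqP/negP=> /negP pm.
have /eqP := gp m pm; rewrite -{1}[d]addn0 eqn_add2l eq_sym mdeg_eq0 => /eqP m0.
by rewrite m0 p0 eqxx in pm.
Qed.

Lemma mgrX d c k p : mgr d c p -> mgr d.+1 c ('X_k * p).
Proof.
move=> gp m; rewrite -mcoeff_msupp => /msuppM_le/allpairsP[[m1 m2] /=].
case; rewrite msuppX inE => /eqP -> m2p ->; rewrite mcoeff_msupp in m2p.
by rewrite mdegD mdeg1 (gp _ m2p) addnCA.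
Qed.

Lemma mgr_sgn d c e p : mgr d c p -> mgr d c ((-1) ^+ e * p).
Proof.
move=> gp; rewrite -signr_odd mulr_sign; case: ifP => // _.
by apply/mgr_ideal/mon_idealN/mgr_ideal.
Qed.

Definition mpart (d c : nat) (p : S) : S :=
  mfilter (fun m => d == (c + mdeg m)%N) p.

Lemma mpart_mgr d c p : mgr d c (mpart d c p).
Proof. exact/mgr_ideal/mon_ideal_mfilter. Qed.

Lemma mpart_id d c p : mgr d c p -> mpart d c p = p.
Proof.
move=> gp; apply/mpolyP=> m; rewrite mcoeff_mfilter; case: eqP => // ne.
by have [->//|/gp/ne] := eqVneq p@_m 0.
Qed.

Lemma mpart_sum d c (I : Type) (r : seq I) (P : pred I) (F : I -> S) :
  mpart d c (\sum_(i <- r | P i) F i) = \sum_(i <- r | P i) mpart d c (F i).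
Proof.
apply/mpolyP=> m; rewrite mcoeff_mfilter !raddf_sum /=; case: ifP => mB.
  by apply: eq_bigr => i _; rewrite mcoeff_mfilter mB.
by rewrite big1 // => i _; rewrite mcoeff_mfilter mB.
Qed.

Lemma mpartB d c p q : mpart d c (p - q) = mpart d c p - mpart d c q.
Proof.
by apply/mpolyP=> m; rewrite mcoeffB !mcoeff_mfilter mcoeffB; case: ifP; rewrite ?subrr.
Qed.

Lemma mpartM d c c' p q : mgr c c' q -> mpart d c' (p * q) = mpart d c p * q.
Proof.
move=> gq; rewrite {1}(mfilter_split (fun m => d == (c + mdeg m)%N) p) mulrDl.
rewrite -[X in mfilter _ p * q + X]opprK mpartB (mpart_id (mgrM (@mpart_mgr _ _ _) gq)).
rewrite -/(mpart _ _ _); apply/(canLR (addrK _)); rewrite -[LHS]addr0; congr (_ + _).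
apply/esym/mpolyP=> m; rewrite mcoeff_mfilter mcoeffN mcoeff0; case: eqP => // dE.
apply/eqP; rewrite oppr_eq0 mcoeff_eq0; apply/negP.
case/msuppM_le/allpairsP=> [[m1 m2] /= [m1p m2q mE]].
rewrite mcoeff_msupp mcoeff_mfilter /= in m1p; rewrite mcoeff_msupp in m2q.
by move: m1p; rewrite dE mE mdegD (gq _ m2q) -addnA [(mdeg m2 + _)%N]addnC eqxx eqxx.
Qed.

Lemma mcoeff0M (p q : S) : (p * q)@_0%MM = p@_0%MM * q@_0%MM.
Proof. exact: (rmorphM (mcoeff (0%MM : mon))). Qed.

End Graded.

Section Betti.

Variables (K : fieldType) (N : nat) (E : exterior_basis N).

Local Notation S := {mpoly K[N]}.
Local Notation mon := 'X_{1..N}.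
Local Notation L := (eb_size E).
Local Notation D := (kdiff E (fun k => 'X_k : S)).

Definition mxgr d n (sh : 'I_n -> nat) (Z : 'M[S]_(L, n)) :=
  forall i k, mgr d (sh k) (Z i k).

(** The Koszul complex resolves the residue field: this is [kreg_nonstd] for the
    graph without edges, applied to each column. *)
Lemma koszul_exact_graded d n (sh : 'I_n -> nat) (Y : 'M[S]_(L, n)) :
  mxgr d.+1 sh Y -> D *m Y = 0 -> (forall i k, (Y i k)@_0%MM = 0) ->
  exists2 Z, mxgr d sh Z & Y = D *m Z.
Proof.
move=> grY DY Y0.
have kreg0 : kreg K E (nonstd (fun _ _ => false) setT) 0.
  have := @kreg_nonstd N (fun _ _ => false) (fun _ _ => erefl) (fun _ => erefl)
    bool (fun _ _ => true) _ K E setT.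
  rewrite (_ : edge_colors _ _ _ = set0) ?cards0; first by apply.
  apply/setP=> c; rewrite [RHS]inE; apply/edge_colorsP.
  by case=> i [j [_ _]].
have std0 (m : mon) : ~~ nonstd (fun _ _ => false) setT m.
  by rewrite negbK subsetT; apply/indepP.
have colE k : exists2 w : 'cV[S]_L,
    forall i, mgr d (sh k) (w i 0) & col k Y = D *m w.
  have DYk : D *m col k Y = 0 by rewrite colE mulmxA DY mul0mx.
  have [kd|dk] := leqP (sh k) d.
    have [|i||w hw Iw] := kreg0 (d - sh k)%N (col k Y) => //.
    - by rewrite mxE -subSn //; apply/mgr_homog; [apply: leqW | apply: grY].
    - by rewrite DYk => i; rewrite mxE; apply: mon_ideal0.
    exists w => [i|]; first by apply/mgr_homog.
    apply/eqP; rewrite -subr_eq0; apply/eqP/matrixP=> i l; rewrite ord1 [RHS]mxE.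
    apply/mpolyP=> m; rewrite mcoeff0; apply/eqP/negP=> /negP /(Iw i m).
    by rewrite (negPf (std0 m)).
  exists 0 => [i m|]; first by rewrite mxE mcoeff0 eqxx.
  rewrite mulmx0; apply/matrixP=> i l; rewrite !mxE.
  have := grY i k; move: dk; rewrite leq_eqVlt => /orP[/eqP <- gY|dk gY].
    by apply: mgr_eq0 gY (Y0 _ _).
  exact: mgr_gt gY.
have [w hw] : exists2 w : 'I_n -> 'cV[S]_L,
    (forall k i, mgr d (sh k) (w k i 0)) & (forall k, col k Y = D *m w k).
  exact: (fin_all_exists2 (fun k => colE k)).
move=> wE; exists (\matrix_(i, k) w k i 0) => [i k|]; first by rewrite mxE.
apply/matrixP=> i k; have := congr1 (fun M : 'cV[S]_L => M i 0) (wE k).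
rewrite mxE => ->; rewrite !mxE; apply: eq_bigr => l _; by rewrite mxE.
Qed.

End Betti.

Section Resolution.

Variables (K : fieldType) (N : nat) (E : exterior_basis N).

Local Notation S := {mpoly K[N]}.
Local Notation mon := 'X_{1..N}.
Local Notation L := (eb_size E).
Local Notation D := (kdiff E (fun k => 'X_k : S)).
Local Notation rk := (@eb_index N E).

Variables (B : pred mon) (I : S -> Prop) (F : free_complex K N).
Hypothesis upB : mon_up B.
Hypothesis IB : forall p, I p <-> mon_ideal B p.
Hypothesis resF : minimal_graded_free_resolution I F.

Lemma mxgr_kdiff d n (sh : 'I_n -> nat) (Z : 'M[S]_(L, n)) :
  mxgr d sh Z -> mxgr d.+1 sh (D *m Z).
Proof.
move=> gZ i k; rewrite -(eb_setK i) kdiff_entry; apply: mgr_sum => l _.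
by rewrite -mulrA; apply/mgr_sgn/mgrX.
Qed.

Lemma mgr_diff p k l : mgr (shift k) (shift l) (diff F p k l).
Proof. by move=> m; rewrite -mcoeff_msupp => /(diff_graded resF). Qed.

Lemma mgr_aug k : mgr (shift k) 0 (aug F k 0).
Proof.
by apply/mgr_homog; rewrite // subn0; apply: aug_graded resF k.
Qed.

Lemma mxgr_diff d p (Z : 'M[S]_(L, rank F p.+1)) :
  mxgr d (@shift _ _ F p.+1) Z -> mxgr d (@shift _ _ F p) (Z *m diff F p).
Proof.
by move=> gZ i k; rewrite mxE; apply: mgr_sum => l _; apply/mgrM/mgr_diff.
Qed.

Lemma mxgr_aug d (Z : 'M[S]_(L, rank F 0)) :
  mxgr d (@shift _ _ F 0) Z -> forall i, mgr d 0 ((Z *m aug F) i 0).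
Proof.
by move=> gZ i; rewrite mxE; apply: mgr_sum => l _; apply/mgrM/mgr_aug.
Qed.

Lemma mcoeff0_mul_diff n p (Z : 'M[S]_(n, rank F p.+1)) i k :
  ((Z *m diff F p) i k)@_0%MM = 0.
Proof.
rewrite mxE raddf_sum big1 // => l _.
by rewrite /= mcoeff0M (diff_minimal resF) mulr0.
Qed.

Lemma mcoeff0_kdiff n (Z : 'M[S]_(L, n)) i k : ((D *m Z) i k)@_0%MM = 0.
Proof.
rewrite -(eb_setK i) kdiff_entry raddf_sum big1 // => l _.
by rewrite /= -mulrA mcoeff0M mcoeff_XM0 mulr0.
Qed.

Lemma resolution_exact p n (Z : 'M[S]_(n, rank F p.+1)) :
  Z *m diff F p = 0 -> exists V, Z = V *m diff F p.+1.
Proof.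
move=> Zd0; have rowP i : exists v, row i Z = v *m diff F p.+1.
  by apply/(exactS resF); rewrite -row_mul Zd0 row0.
have [V VE] := fin_all_exists rowP; exists (\matrix_i V i).
by apply/row_matrixP=> i; rewrite row_mul rowK.
Qed.

Lemma resolution_exact0 n (Z : 'M[S]_(n, rank F 0)) :
  (forall i, mon_ideal B ((Z *m aug F) i 0)) <-> exists V, Z = V *m diff F 0.
Proof.
split=> [ZI|[V ->] i].
  have rowP i : exists v, row i Z = v *m diff F 0.
    by apply/(exact0 resF)/IB; rewrite -row_mul mxE.
  have [V VE] := fin_all_exists rowP; exists (\matrix_i V i).
  by apply/row_matrixP=> i; rewrite row_mul rowK.
apply/IB; have -> : (V *m diff F 0 *m aug F) i 0 = (row i V *m diff F 0 *m aug F) 0 0.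
  by rewrite -!row_mul [RHS]mxE.
by apply/(exact0 resF); exists (row i V).
Qed.

Lemma resolution_lift n (z : 'cV[S]_n) :
  exists W, forall i, mon_ideal B ((z - W *m aug F) i 0).
Proof.
have zP i : exists u, I (z i 0 - (u *m aug F) 0 0) := aug_surj resF (z i 0).
have [W WP] := fin_all_exists zP; exists (\matrix_i W i) => i; apply/IB.
suff -> : (z - (\matrix_i W i) *m aug F) i 0 = z i 0 - (W i *m aug F) 0 0 by [].
rewrite [LHS]mxE [X in _ + X]mxE; congr (_ - _).

transitivity ((row i ((\matrix_i W i) *m aug F)) 0 0); first by rewrite [RHS]mxE.
by rewrite row_mul rowK.
Qed.

Lemma resolution_dd p : diff F p.+1 *m diff F p = 0.
Proof.
apply/row_matrixP=> i; rewrite row0 row_mul; apply/(exactS resF).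
by exists (delta_mx 0 i); rewrite rowE.
Qed.

(** A basis element of too large a degree is carried down the double complex of
    the resolution and the Koszul complex to a Koszul cycle of the quotient,
    which bounds.  Carried back, the basis element is a sum of a Koszul boundary
    and of an element of the image of [diff], whose entries have no constant
    term: a contradiction. *)
Lemma shift_le_kreg r p (k : 'I_(rank F p)) :
  kreg K E B r -> (shift k <= p + r)%N.
Proof.
move=> Br; rewrite leqNgt; apply/negP=> lt_k.
have [j rj shE] : exists2 j, (r <= j)%N & shift k = (p + j.+1)%N.
  exists (shift k - p.+1)%N.
    by rewrite leq_subRL; [rewrite addSn | rewrite (leq_trans _ lt_k) // leq_addr].
  by rewrite addnS -addSn subnKC // (leq_trans _ lt_k) // ltnS leq_addr.
pose gr q (Z : 'M[S]_(L, rank F q)) := mxgr (q + j.+1) (@shift _ _ F q) Z.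
have := @double_complex_down _ L (rank F) D (diff F) gr
  (fun n Z => kdiff_sq _ Z) resolution_dd (fun q Z => @resolution_exact q L Z).
case/(_ _ _ p (delta_mx (rk set0) k) 0).
- move=> q Z gZ DZ; apply: koszul_exact_graded => //; first exact: mxgr_diff.
  by move=> i l; apply: mcoeff0_mul_diff.
- move=> Z Z' gZ DZ; have [||w hw Iw] := Br j (Z *m aug F) rj.
  + by move=> i; have /mgr_homog := mxgr_aug (i := i) gZ; rewrite subn0; apply.
  + rewrite mulmxA DZ; apply/resolution_exact0; by exists Z'.
  have [W WI] := resolution_lift w.
  have [|V VE] := proj1 (resolution_exact0 (Z - D *m W)).
    move=> i; rewrite mulmxBl -mulmxA.
    have -> : Z *m aug F - D *m (W *m aug F) =
      (Z *m aug F - D *m w) + D *m (w - W *m aug F).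
      by rewrite mulmxBr addrA subrK.
    by apply: in_mon_cvD => // l; apply: in_mon_cvM.
  by exists W, V; rewrite -VE addrC subrK.
- move=> i l m; rewrite mxE; case: andP => [[_ /eqP->]|_]; last first.
    by rewrite mulr0n mcoeff0 eqxx.
  rewrite mulr1n mcoeff1 shE; have [->|_] := eqVneq m 0%MM; last by rewrite eqxx.
  by rewrite mdeg0 addn0.
- rewrite mul0mx; apply/matrixP=> i l; rewrite -(eb_setK i) kdiff_entry mxE.
  rewrite big1 // => q qs; rewrite mxE (inj_eq (can_inj (@eb_indexK _ E))).
  by rewrite -subset0 subUset sub1set inE /= mulr0.
move=> W [V]; move/matrixP/(_ (rk set0) k)/(congr1 (mcoeff 0%MM)).
rewrite [X in mcoeff _ X = _]mxE !eqxx mcoeff1 eqxx [X in mcoeff _ X]mxE mcoeffD.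
by rewrite mcoeff0_kdiff mcoeff0_mul_diff addr0 => /eqP; rewrite oner_eq0.
Qed.

(** Conversely, a Koszul cycle of degree above all the shifts is carried up to
    the end of the Koszul complex, where it dies. *)
Lemma kreg_shift_le r j (z : 'cV[S]_L) :
  (forall p (k : 'I_(rank F p)), (shift k <= p + r)%N) -> (r <= j)%N ->
  homog_cv j.+1 z -> in_mon_cv B (D *m z) ->
  exists w, in_mon_cv B (z - D *m w).
Proof.
move=> sh_le rj hz BDz.
pose gr q (Z : 'M[S]_(L, rank F q)) := mxgr (q + j.+1) (@shift _ _ F q) Z.
pose gr' q (Z : 'M[S]_(L, rank F q)) := mxgr (q + j) (@shift _ _ F q) Z.
pose sp c q (Z : 'M[S]_(L, rank F q)) :=
  forall (s : {set 'I_N}) k, (c <= #|s|)%N -> Z (rk s) k = 0.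
have := @double_complex_up _ L (rank F) D (diff F) gr
  (fun n Z => kdiff_sq _ Z) resolution_dd (fun q Z => @resolution_exact q L Z)
  gr' sp.
have [Z0 Z0z gZ0] : exists2 Z, in_mon_cv B (z - Z *m aug F) & gr 0%N Z.
  have [Z ZI] := resolution_lift z.
  pose Z1 : 'M[S]_(L, rank F 0) := \matrix_(i, k) mpart j.+1 (shift k) (Z i k).
  exists Z1; last by move=> i k; rewrite mxE; apply: mpart_mgr.
  move=> i.
  have -> : (z - Z1 *m aug F) i 0 = mpart j.+1 0 ((z - Z *m aug F) i 0).
    rewrite !mxE mpartB mpart_id; last by apply/mgr_homog; rewrite ?subn0.
    congr (_ - _); rewrite mpart_sum; apply: eq_bigr => l _.
    by rewrite mxE (mpartM _ _ (@mgr_aug l)).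
  by move=> m; rewrite mcoeff_mfilter; case: ifP => _; [apply: ZI | rewrite eqxx].
have [V DZ0] : exists V, D *m Z0 = V *m diff F 0.
  apply/resolution_exact0 => i; rewrite -mulmxA.
  have -> : D *m (Z0 *m aug F) = D *m z - D *m (z - Z0 *m aug F).
    by rewrite -mulmxBr opprB addrC subrK.
  by apply: in_mon_cvB => // l; apply: in_mon_cvM.
case/(_ _ _ _ _ N.+1 0%N Z0 V) => //.
- by move=> q i k m; rewrite mxE mcoeff0 eqxx.
- by move=> q Z spZ; apply: matrix_setP => s k; rewrite spZ // mxE.
- move=> c q Z W gZ spZ DZ.
  pose Z' : 'M[S]_(L, rank F q.+1) := \matrix_(i, l)
    if (c <= #|eb_set i|)%N then 0 else mpart (q + j.+1).+1 (shift l) (W i l).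
  exists Z'; split.
  + move=> i l; rewrite mxE; case: ifP => _; last exact: mpart_mgr.
    by move=> m; rewrite mcoeff0 eqxx.
  + by move=> s k cs; rewrite mxE eb_indexK cs.
  apply/matrixP=> i k; rewrite [RHS]mxE.
  have [ci|ci] := boolP (c <= #|eb_set i|)%N.
    rewrite [RHS]big1 => [|l _]; last by rewrite mxE ci mul0r.
    rewrite -(eb_setK i) kdiff_entry big1 // => x xs.
    by rewrite spZ ?mulr0 // cardsU1 xs.
  rewrite -[LHS](mpart_id (@mxgr_kdiff _ _ _ _ gZ i k)) DZ mxE mpart_sum.
  apply: eq_bigr => l _; rewrite [in RHS]mxE (negPf ci).
  by rewrite (mpartM _ _ (@mgr_diff q l k)).
- move=> q Z W gZ gW DZW; apply: koszul_exact_graded => //.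
  + move=> i k; rewrite 2!mxE -addnS; apply: mgrB; first exact: gZ.
    by apply: mxgr_diff; rewrite addnS -addSn.
  move=> i k; rewrite 2!mxE mcoeffB mcoeff0_mul_diff subr0.
  apply/eqP/negP=> /negP/gZ; rewrite mdeg0 addn0 => shE.
  have := sh_le q k; rewrite -shE leq_add2l => /(leq_trans)/(_ rj).
  by rewrite ltnn.
- by move=> s k; rewrite ltnNge -[X in (_ <= X)%N]card_ord max_card.
move=> W [V' [_ Z0E]]; exists (W *m aug F).
have -> : z - D *m (W *m aug F) = (z - Z0 *m aug F) + V' *m diff F 0 *m aug F.
  by rewrite {1}Z0E mulmxDl mulmxA opprD addrA subrK.
by apply: in_mon_cvD => //; apply/resolution_exact0; exists V'.
Qed.

End Resolution.

(** * Induced matchings *)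

Section InducedMatching.

Variables (K : fieldType) (N : nat) (g : rel 'I_N) (Q : finType).
Variable P : Q -> bool -> 'I_N.
Hypothesis P_inj : forall q b q' b', P q b = P q' b' -> q = q' /\ b = b'.
Hypothesis gP : forall q b q' b', g (P q b) (P q' b') = (q == q') && (b != b').

Local Notation S := {mpoly K[N]}.
Local Notation mon := 'X_{1..N}.

Implicit Types (c : {ffun Q -> bool}) (q : Q).

(** The two ends of an edge of the matching are consecutive, so that exchanging
    them in an exterior monomial changes exactly one sign. *)
Definition matching_pos (x : 'I_N) : nat :=
  if [pick u : Q * bool | P u.1 u.2 == x] is Some u
  then ((enum_rank u.1).*2 + u.2)%N else (#|Q|.*2 + x)%N.

Lemma matching_posE q b : matching_pos (P q b) = ((enum_rank q).*2 + b)%N.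
Proof.
rewrite /matching_pos; case: pickP => [[q' b'] /= /eqP/P_inj[-> ->] //|].
by move/(_ (q, b)); rewrite eqxx.
Qed.

Lemma matching_pos_inj : injective matching_pos.
Proof.
have ltQ (u : Q * bool) y : ((enum_rank u.1).*2 + u.2 < #|Q|.*2 + y)%N.
  rewrite (leq_trans _ (leq_addr _ _)) // -(ltn_half_double) //.
  by rewrite addnC halfD; case: u.2; rewrite ?odd_double ?doubleK ?andbF ?addn0 ?add0n ltn_ord.
move=> x y; rewrite /matching_pos.
case: pickP => [u /eqP <-|_]; case: pickP => [v /eqP <-|_].
- move=> uv; have b_eq : u.2 = v.2.
    by have /(congr1 odd) := uv; rewrite !oddD !odd_double !addFb; case: u.2 v.2 => [] [].
  by move: uv; rewrite b_eq => /addIn/double_inj/val_inj/enum_rank_inj ->.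
- by move=> uv; have := ltQ u y; rewrite uv ltnn.
- by move=> uv; have := ltQ v x; rewrite uv ltnn.
by move/addnI/val_inj.
Qed.

Definition transversal c : {set 'I_N} := [set P q (c q) | q : Q].

Definition cotransversal c : mon := (\sum_q U_(P q (~~ c q)))%MM.

Lemma in_transversal c q b : (P q b \in transversal c) = (b == c q).
Proof.
apply/imsetP/eqP=> [[q' _ /P_inj[-> ->]] //|->]; by exists q.
Qed.

Lemma cotransversalE c x :
  (cotransversal c x != 0%N) = (x \in [set P q (~~ c q) | q : Q]).
Proof.
rewrite /cotransversal mnm_sumE sum_nat_eq0 negb_forall.
apply/existsP/imsetP=> [[q]|[q _ ->]].
  by rewrite /= mnm1E eqb0 negbK => /eqP <-; exists q.
by exists q; rewrite /= mnm1E eqxx.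
Qed.

Lemma cotransversal_std c : ~~ nonstd g setT (cotransversal c).
Proof.
rewrite negbK subsetT; apply/indepP=> i j; rewrite !inE !cotransversalE.
case/imsetP=> [q _ ->] /imsetP[q' _ ->]; rewrite gP.
by case: eqP => // ->; rewrite eqxx.
Qed.

Lemma mcoeffXM k (p : S) m :
  ('X_k * p)@_m = if m k != 0%N then p@_(m - U_(k)) else 0.
Proof.
rewrite mulrC; case: ifP => [mk|/negbFE/eqP mk0].
  by rewrite -{1}(@submK _ U_(k)%MM m) ?lep1mP // addmC mcoeffMX.
apply/eqP; rewrite mcoeff_eq0; apply/negP=> /msuppM_le/allpairsP[[m1 m2] /=].
case=> _; rewrite msuppX inE => /eqP -> mE.
by move: mk0; rewrite mE mnmDE mnm1E eqxx addn1.
Qed.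

Lemma mcoeff_sgn e (p : S) m : ((-1) ^+ e * p)@_m = (-1) ^+ e * p@_m.
Proof.
by rewrite -(signr_odd S) -(signr_odd K) !mulr_sign; case: ifP; rewrite ?mcoeffN.
Qed.

Variable E : exterior_basis N.
Hypothesis posE : @eb_pos _ E =1 matching_pos.

Local Notation L := (eb_size E).
Local Notation D := (kdiff E (fun k => 'X_k : S)).
Local Notation rk := (@eb_index N E).

(** The fundamental cocycle of the boundary of a cross-polytope, whose facets are
    the transversals of the matching, in the multidegree of all its vertices. *)
Definition matching_form (u : 'cV[S]_L) : K :=
  \sum_c (u (rk (transversal c)) 0)@_(cotransversal c).

Lemma matching_form_ideal u :
  in_mon_cv (nonstd g setT) u -> matching_form u = 0.
Proof.
move=> Iu; rewrite /matching_form big1 // => c _; apply/eqP/negP=> /negP/Iu.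
by rewrite (negPf (cotransversal_std c)).
Qed.

Definition flip q c : {ffun Q -> bool} := [ffun q' => (q' == q) (+) c q'].

Lemma flipK q : involutive (flip q).
Proof. by move=> c; apply/ffunP=> q'; rewrite !ffunE addKb. Qed.

Lemma transversal_flip q c :
  P q (c q) |: transversal (flip q c) = P q (~~ c q) |: transversal c.
Proof.
apply/setP=> x; rewrite !in_setU1.
have [->|xc] := eqVneq x (P q (c q)); first by rewrite /= in_transversal eqxx orbT.
have [->|xnc] /= := eqVneq x (P q (~~ c q)).
  by rewrite in_transversal ffunE eqxx addTb eqxx.
apply/imsetP/imsetP=> -[q' _ xE]; exists q' => //; move: xE xc xnc; rewrite ffunE.
  by have [->|_] := eqVneq q' q; rewrite // addTb => ->; rewrite eqxx.
by have [->|_] := eqVneq q' q; rewrite // => ->; rewrite eqxx.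
Qed.

Lemma cotransversal_flip q c :
  (cotransversal (flip q c) - U_(P q (c q)) =
   cotransversal c - U_(P q (~~ c q)))%MM.
Proof.
rewrite /cotransversal [in LHS](bigD1 q) //= [in RHS](bigD1 q) //=.
rewrite ffunE eqxx addTb negbK ![(U_(_) + _)%MM]addmC !addmK.
by apply: eq_bigr => q' /negPf q'q; rewrite ffunE q'q.
Qed.

Lemma kpos_flip q c : c q ->
  kpos E (transversal (flip q c)) (P q (c q)) =
  (kpos E (transversal c) (P q (~~ c q))).+1.
Proof.
move=> cq; rewrite cq /kpos.
set X := [set i in transversal c | _].
have -> : [set i in transversal (flip q c) | (eb_pos E i < eb_pos E (P q true))%N]
    = P q false |: X.
  apply/setP=> x; rewrite in_setU1 !inE !posE.
  have [->|xq] /= := eqVneq x (P q false).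
    by rewrite in_transversal ffunE eqxx cq !matching_posE addn0 addn1 ltnS leqnn.
  apply/andP/andP=> -[/imsetP[q' _ xE] lt_x]; move: xE xq lt_x; rewrite ?ffunE.
    have [->|q'q] := eqVneq q' q; first by rewrite cq => ->; rewrite eqxx.
    move=> -> _; rewrite in_transversal addFb eqxx !matching_posE => lt_x.
    split=> //; have: enum_rank q' != enum_rank q by rewrite (inj_eq enum_rank_inj).
    rewrite neq_ltn => /orP[] lt_q; last first.
      move: lt_x; rewrite addn1 ltnS leqNgt; case/negP.
      by rewrite (leq_trans _ (leq_addr _ _)) // ltn_double.
    rewrite addn0 -(ltn_half_double) //.
    by rewrite addnC halfD; case: (c q'); rewrite ?odd_double ?doubleK ?andbF ?addn0 ?add0n.
  move=> -> _ lt_x.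
  have q'q : q' != q.
    by apply: contraTneq lt_x => ->; rewrite !matching_posE cq addn0 addn1 ltnNge leqnSn.
  rewrite in_transversal ffunE (negPf q'q) eqxx; split=> //.
  by rewrite (ltn_trans lt_x) // !matching_posE addn0 addn1.
by rewrite cardsU1 !inE !posE ltnn andbF.
Qed.

(** An exterior monomial containing both ends of an edge of the matching
    contributes through two transversals, with opposite signs. *)
Lemma matching_form_boundary w : matching_form (D *m w) = 0.
Proof.
pose F q c := (-1) ^+ kpos E (transversal c) (P q (~~ c q)) *
  (w (rk (P q (~~ c q) |: transversal c)) 0)@_(cotransversal c - U_(P q (~~ c q)))%MM.
transitivity (\sum_c \sum_q F q c).
  apply: eq_bigr => c _; rewrite kdiff_entry raddf_sum /=.
  pose h q := P q (~~ c q).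
  have h_inj : {in setT &, injective h} by move=> q q' _ _ /P_inj[].
  rewrite [RHS](eq_bigl (fun q => q \in setT)) => [|q]; last by rewrite inE.
  rewrite -(big_imset (fun k => (-1) ^+ kpos E (transversal c) k *
    (w (rk (k |: transversal c)) 0)@_(cotransversal c - U_(k))%MM) h_inj) /=.
  rewrite big_mkcond [RHS]big_mkcond; apply: eq_bigr => k _.
  rewrite -mulrA mcoeff_sgn mcoeffXM cotransversalE.
  have -> : [set P q (~~ c q) | q : Q] = [set h q | q in setT].
    by apply/setP=> x; apply/imsetP/imsetP=> -[q _ ->]; exists q.
  have [/imsetP[q _ ->]|] := boolP (k \in [set h q | q in setT]); last first.
    by rewrite mulr0 if_same.
  by rewrite in_transversal; case: (c q).
rewrite exchange_big big1 //= => q _.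
rewrite (bigID (fun c => c q)) /= [X in _ + X](reindex_inj (inv_inj (flipK q))) /=.
rewrite [X in _ + X](eq_bigl (fun c => c q)) => [|c]; last by rewrite /= ffunE eqxx addTb negbK.
rewrite -big_split big1 //= => c cq; rewrite /F ffunE eqxx addTb negbK.
by rewrite kpos_flip // transversal_flip cotransversal_flip exprS mulN1r mulNr addrN.
Qed.

Definition matching_cycle : 'cV[S]_L :=
  \col_i if eb_set i == [set P q true | q : Q] then \prod_q 'X_(P q false) else 0.

Lemma prod_X : \prod_q 'X_(P q false) = 'X_[cotransversal [ffun=> true]] :> S.
Proof.
rewrite /cotransversal; under [in RHS]eq_bigr do rewrite ffunE.
by elim/big_rec2: _ => [|q m p _ ->]; rewrite ?mpolyX0 // mpolyXD.
Qed.

Lemma homog_matching_cycle : homog_cv #|Q| matching_cycle.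
Proof.
move=> i; rewrite mxE; case: ifP => _; last exact: rpred0.
rewrite prod_X dhomogX /= /cotransversal mdeg_sum.
by rewrite (eq_bigr (fun=> 1%N)) => [|q _]; rewrite ?sum1_card //= mdeg1.
Qed.

Lemma matching_cycleP : in_mon_cv (nonstd g setT) (D *m matching_cycle).
Proof.
move=> i; rewrite -(eb_setK i) kdiff_entry; set s := eb_set i.
apply: mon_ideal_sum => k ks; rewrite mxE eb_indexK; case: eqP => [sE|_]; last first.
  by rewrite mulr0; apply: mon_ideal0.
have /imsetP[q _ kE] : k \in [set P q true | q : Q] by rewrite -sE setU11.
rewrite -mulrA => m; rewrite mcoeff_sgn prod_X -mpolyXD mcoeffX.
case: (eqVneq _ m) => [<- _|_]; last by rewrite mulr0 eqxx.
rewrite /nonstd subsetT /=; apply/indepP=> /(_ (P q true) (P q false)).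
rewrite !inE !mnmDE kE !mnm1E eqxx !addn_eq0 !negb_and (cotransversalE _ (P q false)).
have -> : P q false \in [set P q (~~ [ffun=> true] q) | q : Q].
  by apply/imsetP; exists q => //; rewrite ffunE.
by rewrite orbT gP eqxx => /(_ isT isT).
Qed.

(** [matching_form] vanishes on boundaries and on the ideal, but takes the value 1
    on the cycle. *)
Lemma matching_cycle_not_boundary w :
  ~ in_mon_cv (nonstd g setT) (matching_cycle - D *m w).
Proof.
move/matching_form_ideal.
have -> : matching_form (matching_cycle - D *m w) =
    matching_form matching_cycle - matching_form (D *m w).
  rewrite /matching_form -sumrB; apply: eq_bigr => c _.
  by rewrite mxE [X in _ + X]mxE mcoeffB.
rewrite matching_form_boundary subr0 /matching_form (bigD1 [ffun=> true]) //=.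
have trE : transversal [ffun=> true] = [set P q true | q : Q].
  by apply: eq_imset => q; rewrite ffunE.
rewrite mxE eb_indexK trE eqxx prod_X mcoeffX eqxx big1 ?addr0.
  by move/eqP; rewrite oner_eq0.
move=> c; apply: contraNeq; rewrite mxE eb_indexK; case: ifP => [/eqP cE _|_]; last first.
  by rewrite mcoeff0 eqxx.
apply/eqP/ffunP=> q; rewrite ffunE.
have : P q true \in transversal c by rewrite cE; apply/imsetP; exists q.
by rewrite in_transversal => /eqP.
Qed.

End InducedMatching.

Import Num.Theory.

(** * Hilbert series *)

Section HilbertFunction.

Variables (K : fieldType) (N : nat) (B : pred 'X_{1..N}).

Local Notation S := {mpoly K[N]}.
Local Notation mon := 'X_{1..N}.

Definition mnm_of M (c : {ffun 'I_N -> 'I_M}) : mon := [multinom val (c i) | i < N].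

Lemma mnm_of_inj M : injective (@mnm_of M).
Proof.
move=> c c' /mnmP cc'; apply/ffunP=> i; apply: val_inj.
by have := cc' i; rewrite !mnmE.
Qed.

Lemma mnm_of_surj M (m : mon) :
  (mdeg m < M)%N -> exists c : {ffun 'I_N -> 'I_M}, mnm_of c = m.
Proof.
move=> mM; have lt_m i : (m i < M)%N.
  by apply: leq_ltn_trans mM; rewrite mdegE (bigD1 i) //= leq_addr.
exists [ffun i => Ordinal (lt_m i)]; apply/mnmP=> i.
by rewrite mnmE ffunE.
Qed.

(** The standard monomials of degree [k], encoded by exponents less than [M] so as
    to form a finite product; nothing is missed when [k < M]. *)
Definition std_exps M k : {set {ffun 'I_N -> 'I_M}} :=
  [set c | (mdeg (mnm_of c) == k) && ~~ B (mnm_of c)].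

(** The standard monomials of degree [k] form a basis, and two bases have the
    same size. *)
Lemma quot_dim_unique (I : S -> Prop) M k d : (forall p, I p <-> mon_ideal B p) ->
  (k < M)%N -> quot_dim I k d -> d = #|std_exps M k|.
Proof.
move=> IB kM [b [hb free span]].
pose q := #|std_exps M k|; pose mn (j : 'I_q) := mnm_of (enum_val j).
have mnP j : mdeg (mn j) = k /\ ~~ B (mn j).
  by have := enum_valP j; rewrite inE => /andP[/eqP].
pose cv (p : S) : 'rV[K]_q := \row_j p@_(mn j).
have cvI p : p \is k.-homog -> cv p = 0 <-> I p.
  move=> /dhomogP hp; split=> [/rowP p0|/IB Ip]; last first.
    apply/rowP=> j; rewrite !mxE; apply/eqP/negP=> /negP/Ip.
    by case: (mnP j) => _ /negPf ->.
  apply/IB => m pm; apply/negPn/negP=> nBm.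
  have mk : mdeg m = k by apply: hp; rewrite mcoeff_msupp.
  have [|c cm] := @mnm_of_surj M m; first by rewrite mk.
  have c_std : c \in std_exps M k by rewrite inE cm mk eqxx.
  have := p0 (enum_rank_in c_std c); rewrite !mxE /mn enum_rankK_in // cm => p0m.
  by rewrite p0m eqxx in pm.
have cv_sum n (c : 'I_n -> K) (F : 'I_n -> S) :
    cv (\sum_i c i *: F i) = (\row_i c i) *m (\matrix_i cv (F i)).
  apply/rowP=> j; rewrite !mxE raddf_sum; apply: eq_bigr => i _.
  by rewrite /= mcoeffZ !mxE.
have hcomb (c : 'I_d -> K) : \sum_i c i *: b i \is k.-homog.
  by apply: rpred_sum => i _; apply: rpredZ.
(* The basis of the quotient expressed in that of the standard monomials. *)
pose A := \matrix_i cv (b i).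
have freeA : row_free A.
  apply: inj_row_free => v vA0; apply/rowP=> i; rewrite mxE.
  apply: (free (fun i => v 0 i)); apply/cvI => //; rewrite cv_sum -[RHS]vA0.
  by congr (_ *m _); apply/rowP=> j; rewrite mxE.
have fullA : row_full A.
  have spanj j : exists v : 'rV[K]_d, v *m A = cv 'X_[mn j].
    have hX : ('X_[mn j] : S) \is k.-homog.
      by rewrite dhomogX; case: (mnP j) => /= ->.
    have [c Ic] := span 'X_[mn j] hX; exists (\row_i c i).
    have /cvI : 'X_[mn j] - \sum_i c i *: b i \is k.-homog by rewrite rpredB.
    move=> /(proj2)/(_ Ic) cv0; rewrite -cv_sum; apply/esym/eqP; rewrite -subr_eq0.
    by rewrite -cv0; apply/eqP/rowP=> i; rewrite !mxE mcoeffB.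
  have [V VA] := fin_all_exists spanj; apply/row_fullP; exists (\matrix_j V j).
  apply/row_matrixP=> j; rewrite row_mul rowK VA; apply/rowP=> i.
  by rewrite !mxE mcoeffX (inj_eq (@mnm_of_inj M)) (inj_eq enum_val_inj).
by move: freeA fullA; rewrite /row_free /row_full => /eqP -> /eqP.
Qed.

End HilbertFunction.

Section HilbertSeries.

Variables (N : nat) (g : rel 'I_N).

Local Notation B := (nonstd g setT).

Definition exp_supp M (c : {ffun 'I_N -> 'I_M}) : {set 'I_N} :=
  [set i | val (c i) != 0%N].

Lemma mnm_supp_of M (c : {ffun 'I_N -> 'I_M}) : mnm_supp (mnm_of c) = exp_supp c.
Proof. by apply/setP=> i; rewrite !inE mnmE. Qed.

Definition hilb_poly M : {poly int} :=
  \sum_(c : {ffun 'I_N -> 'I_M} | indep g (exp_supp c)) 'X^(\sum_i c i).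

Lemma coef_hilb_poly M k : (hilb_poly M)`_k = #|std_exps B M k|%:Z.
Proof.
rewrite /hilb_poly coef_sum -sum1_card -natz natr_sum big_mkcond [RHS]big_mkcond.
apply: eq_bigr => c _; rewrite inE /nonstd negbK subsetT mnm_supp_of.
rewrite coefXn mdegE eq_sym; under [in RHS]eq_bigr do rewrite mnmE.
by case: (indep _ _); case: (_ == k).
Qed.

Definition eqXn M (p q : {poly int}) := forall k, (k < M)%N -> p`_k = q`_k.

Lemma eqXn_refl M p : eqXn M p p. Proof. by []. Qed.

Lemma eqXnM M p q p' q' : eqXn M p q -> eqXn M p' q' -> eqXn M (p * p') (q * q').
Proof.
move=> pq pq' k kM; rewrite !coefM; apply: eq_bigr => i _.
rewrite pq ?pq' //; first by rewrite (leq_ltn_trans (leq_subr _ _)).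
by apply: leq_ltn_trans kM; rewrite -ltnS.
Qed.

Lemma eqXnX M p q e : eqXn M p q -> eqXn M (p ^+ e) (q ^+ e).
Proof.
by move=> pq; elim: e => [|e IHe]; rewrite ?expr0 // !exprS; apply: eqXnM.
Qed.

Lemma eqXn_sum M (I : Type) (r : seq I) (P : pred I) (F G : I -> {poly int}) :
  (forall i, P i -> eqXn M (F i) (G i)) ->
  eqXn M (\sum_(i <- r | P i) F i) (\sum_(i <- r | P i) G i).
Proof.
by move=> FG k kM; rewrite !coef_sum; apply: eq_bigr => i /FG; apply.
Qed.

Lemma geometric_X M :
  (1 - 'X) * (\sum_(a < M.+1 | val a != 0%N) 'X^a) = 'X - 'X^(M.+1) :> {poly int}.
Proof.
rewrite big_mkcond big_ord_recl /= add0r.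
elim: M => [|M IHM]; first by rewrite big_ord0 mulr0 expr1 subrr.
rewrite big_ord_recr /= mulrDr [in LHS](_ : bump 0 M = M.+1) // IHM.
by rewrite mulrBl mul1r -exprS addrA subrK.
Qed.

(** Once the support is fixed, the exponents on it are independent and positive. *)
Lemma hilb_poly_supp M : hilb_poly M.+1 =
  \sum_(F : {set 'I_N} | indep g F) (\sum_(a < M.+1 | val a != 0%N) 'X^a) ^+ #|F|.
Proof.
rewrite /hilb_poly (partition_big (@exp_supp M.+1) (indep g)) //=.
apply: eq_bigr => F iF.
transitivity (\prod_i \sum_(a < M.+1 | (val a != 0%N) == (i \in F)) ('X^a : {poly int})).
  rewrite bigA_distr_big_dep /=; apply: eq_big => [c|c _]; last by rewrite prodrXr.
  apply/andP/familyP=> [[_ /eqP <-] i|cF]; first by rewrite unfold_in inE eqxx.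
  have -> : exp_supp c = F by apply/setP=> i; rewrite inE; have := cF i; rewrite unfold_in => /eqP.
  by rewrite iF eqxx.
rewrite (bigID (mem F)) /= [X in _ * X]big1 ?mulr1 => [|i iF'].
  rewrite -prodr_const; apply: eq_bigr => i iF'.
  by apply: eq_bigl => a; rewrite iF' eqb_id.
rewrite (big_pred1 ord0) ?expr0 // => a.
by rewrite (negPf iF') eqbF_neg negbK.
Qed.

(** The numerator of the Hilbert series over [(1 - 'X) ^+ d0]. *)
Definition supp_poly d0 : {poly int} :=
  \sum_(F : {set 'I_N} | indep g F) 'X^#|F| * (1 - 'X) ^+ (d0 - #|F|).

Lemma hilb_poly_rational M d0 :
  (forall F, indep g F -> (#|F| <= d0)%N) ->
  eqXn M.+1 (hilb_poly M.+1 * (1 - 'X) ^+ d0) (supp_poly d0).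
Proof.
move=> le_d0; rewrite hilb_poly_supp mulr_suml; apply: eqXn_sum => F /le_d0 leF.
rewrite -{1}(subnK leF) exprD mulrCA mulrC -exprMn [_ * (1 - 'X)]mulrC geometric_X.
apply: eqXnM => //; apply: eqXnX => k kM.
by rewrite coefB !coefXn (ltn_eqF kM) subr0.
Qed.

(** The value of [supp_poly d0] at 1 counts the independent sets of size [d0], so
    the series has a pole of order exactly [d0] at 1: a smaller [d] would not
    clear it. *)
Lemma h_poly_supp_poly (h : {poly int}) (H : nat -> nat) d d0 :
  (forall k M, (k < M)%N -> H k = #|std_exps B M k|) ->
  (forall k, h`_k =
     \sum_(i < k.+1) (H i)%:Z * (((1 - 'X) ^+ d : {poly int})`_(k - i))) ->
  (forall F, indep g F -> (#|F| <= d0)%N) ->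
  (exists2 F, indep g F & #|F| = d0) -> (d <= d0)%N -> h = supp_poly d0.
Proof.
move=> HE hE le_d0 [F0 iF0 cF0] dd0.
have h_eq M : eqXn M.+1 h (hilb_poly M.+1 * (1 - 'X) ^+ d).
  move=> k kM; rewrite hE coefM; apply: eq_bigr => i _.
  by rewrite coef_hilb_poly -HE // (leq_ltn_trans _ kM) // -ltnS.
have hQ : h * (1 - 'X) ^+ d0 = supp_poly d0 * (1 - 'X) ^+ d.
  apply/polyP=> k; have kk : (k < k.+1)%N by [].
  have e1 := eqXnM (h_eq k) (@eqXn_refl k.+1 ((1 - 'X) ^+ d0)).
  have e2 := eqXnM (@hilb_poly_rational k _ le_d0) (@eqXn_refl k.+1 ((1 - 'X) ^+ d)).
  by rewrite e1 // -e2 // mulrAC.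
have nz1X : (1 - 'X : {poly int}) != 0 by rewrite -opprB oppr_eq0 polyXsubC_eq0.
have hQ' : h * (1 - 'X) ^+ (d0 - d) = supp_poly d0.
  apply: (mulIf (expf_neq0 d nz1X)).
  by rewrite -mulrA -exprD subnK // hQ.
move: dd0; rewrite leq_eqVlt => /orP[/eqP dE|lt_d].
  by rewrite -hQ' dE subnn mulr1.
have := congr1 (fun p => p.[1]) hQ'; rewrite /= hornerM horner_exp.
rewrite !hornerE subrr expr0n subn_eq0 leqNgt lt_d mulr0 /supp_poly horner_sum.
move/esym/eqP; rewrite psumr_eq0 => [|F iF].
  move/allP/(_ F0 (mem_index_enum _)); rewrite iF0 cF0 subnn /= expr0 mulr1.
  by rewrite hornerXn expr1n.
by rewrite hornerM horner_exp !hornerE subrr expr1n mul1r exprn_ge0.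
Qed.

(** The coefficient of ['X^d0] is, up to sign, the value of the independence
    polynomial at -1. *)
Lemma size_supp_poly d0 :
  (forall F, indep g F -> (#|F| <= d0)%N) ->
  \sum_(F : {set 'I_N} | indep g F) (-1) ^+ #|F| != 0 :> int ->
  size (supp_poly d0) = d0.+1.
Proof.
move=> le_d0 nz.
have powE e : (1 - 'X : {poly int}) ^+ e = ((-1) ^+ e)%:P * ('X - 1%:P) ^+ e.
  have -> : 1 - 'X = (-1)%:P * ('X - 1%:P) :> {poly int} by rewrite polyCN mulN1r opprB.
  by rewrite exprMn -polyC_exp.
have size1X e : size ((1 - 'X : {poly int}) ^+ e) = e.+1.
  by rewrite powE mul_polyC size_scale ?signr_eq0 // size_exp_XsubC.
have coef1X e : ((1 - 'X : {poly int}) ^+ e)`_e = (-1) ^+ e.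
  rewrite powE coefCM; have /monicP := monic_exp e (monicXsubC (1 : int)).
  by rewrite lead_coefE size_exp_XsubC => ->; rewrite mulr1.
apply/eqP; rewrite eqn_leq; apply/andP; split.
  apply: (leq_trans (size_sum _ _ _)); apply/bigmax_leqP => F /le_d0 leF.
  rewrite (leq_trans (size_polyMleq _ _)) // size_polyXn size1X.
  by rewrite addSn addnS /= ltnS subnKC.
rewrite ltnNge; apply/negP => /leq_sizeP/(_ d0 (leqnn _))/eqP; apply/negP.
rewrite coef_sum.
have -> : \sum_(F | indep g F) ('X^#|F| * (1 - 'X : {poly int}) ^+ (d0 - #|F|))`_d0
  = (-1) ^+ d0 * \sum_(F : {set 'I_N} | indep g F) (-1) ^+ #|F|.
  rewrite mulr_sumr; apply: eq_bigr => F /le_d0 leF.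
  rewrite coefXnM ltnNge leF /= coef1X -[in RHS](subnK leF) exprD -mulrA -exprMn.
  by rewrite mulrNN mulr1 expr1n mulr1.
by rewrite mulf_neq0 // signr_eq0.
Qed.

End HilbertSeries.

(** * Krull dimension *)

Section PrimeChains.

Variables (K : fieldType) (N : nat).

Local Notation S := {mpoly K[N]}.
Local Notation mon := 'X_{1..N}.

Lemma prime_ideal_sub (P : S -> Prop) p q : is_prime_ideal P -> P (p + q) -> P q -> P p.
Proof.
case=> [[_ PD PM] _ _] Ppq Pq; rewrite -(addrK q p); apply: PD => //.
by rewrite -mulN1r; apply: PM.
Qed.

Lemma prime_ideal_exp (P : S -> Prop) p q e :
  is_prime_ideal P -> ~ P p -> P (p ^+ e * q) -> P q.
Proof.
move=> primeP nPp; elim: e => [|e IHe]; first by rewrite expr0 mul1r.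
rewrite exprS -mulrA => Pe; apply: IHe; case: primeP => _ _ /(_ _ _ Pe).
by case.
Qed.

Lemma big_tuple_cons (R : nmodType) (T : finType) l (F : l.+1.-tuple T -> R) :
  \sum_t F t = \sum_x \sum_(t : l.-tuple T) F [tuple of x :: t].
Proof.
rewrite pair_big /= (reindex (fun u : T * l.-tuple T => [tuple of u.1 :: u.2])) //=.
exists (fun t => (thead t, [tuple of behead t])) => [[x t] _|t _] /=.
  by congr (_, _); apply: val_inj.
by rewrite -tuple_eta.
Qed.

(** Along a chain of primes, elements that enter one at a time are
    algebraically independent modulo the smallest prime: in a relation, the
    terms of lowest degree in the first element dominate. *)
Lemma prime_chain_independent M l (P : nat -> S -> Prop) (a : nat -> S)
    (c : l.-tuple 'I_M -> K) :
  (forall i, (i <= l)%N -> is_prime_ideal (P i)) ->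
  (forall i, (i < l)%N -> forall p, P i p -> P i.+1 p) ->
  (forall i, (i < l)%N -> P i.+1 (a i) /\ ~ P i (a i)) ->
  P 0%N (\sum_t c t *: \prod_(i < l) a i ^+ tnth t i) -> forall t, c t = 0.
Proof.
elim: l => [|l IHl] in P a c * => primeP subP aP.
  rewrite (big_pred1 [tuple]) => [|t]; last by apply/esym/eqP/val_inj; case: t => -[].
  rewrite big_ord0 => Pc t; rewrite (tuple0 t).
  have [//|nz] := eqVneq (c [tuple]) 0.
  case: (primeP 0%N isT) => -[_ _ PM] P1 _; case: P1.
  have := PM ((c [tuple])^-1)%:MP _ Pc.
  by rewrite mul_mpolyC scalerA mulVf // scale1r.
(* The relation as a polynomial in the first element. *)
pose q k := \sum_(t : l.-tuple 'I_M) c [tuple of k :: t] *: \prod_(i < l) a i.+1 ^+ tnth t i.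
have -> : \sum_t c t *: \prod_(i < l.+1) a i ^+ tnth t i = \sum_(k < M) a 0%N ^+ k * q k.
  rewrite big_tuple_cons; apply: eq_bigr => k _; rewrite mulr_sumr.
  apply: eq_bigr => t _; rewrite -scalerAr big_ord_recl; congr (_ *: (_ * _)).
  by apply: eq_bigr => i _; rewrite tnthS.
have [Pa0 nPa0] := aP 0%N isT.
move=> Pq; have cq0 n (k : 'I_M) : val k = n -> forall t : l.-tuple 'I_M, c [tuple of k :: t] = 0.
  elim/ltn_ind: n k => n IHn k kn; apply: (IHl (fun i => P i.+1) (fun i => a i.+1)).
  - by move=> i il; apply: primeP.
  - by move=> i il; apply: subP.
  - by move=> i il; apply: aP.
  have q0 (k' : 'I_M) : (k' < k)%N -> q k' = 0.
    by rewrite kn => lt_k'; rewrite /q big1 // => t _; rewrite (IHn _ lt_k') // scale0r.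
  pose b := \sum_(k' < M | (k < k')%N) a 0%N ^+ (k' - k.+1) * q k'.
  have qE : \sum_(k' < M) a 0%N ^+ k' * q k' = a 0%N ^+ k * (q k + a 0%N * b).
    rewrite (bigD1 k) //= mulrDr; congr (_ + _).
    rewrite (bigID (fun k' : 'I_M => (k < k')%N)) /= [X in _ + X]big1 ?addr0; last first.
      move=> k' /andP[k'k]; rewrite -leqNgt leq_eqVlt (inj_eq val_inj) (negPf k'k).
      by move/q0 ->; rewrite mulr0.
    rewrite /b !mulr_sumr; apply: eq_big => [k'|k' /andP[_ kk']].
      by case: ltnP => [/gtn_eqF|]; rewrite ?andbF // -(inj_eq val_inj) => ->.
    by rewrite !mulrA -exprSr -exprD subnKC.
  rewrite qE in Pq; have := prime_ideal_exp (primeP 0%N isT) nPa0 Pq.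
  move/(subP 0%N isT)/(prime_ideal_sub (primeP 1%N isT)); apply.
  by rewrite mulrC; case: (primeP 1%N isT) => -[_ _ PM] _ _; apply: PM.
move=> t; rewrite (tuple_eta t); exact: cq0 erefl _.
Qed.

Variables (g : rel 'I_N) (d0 : nat).
Hypothesis le_d0 : forall F, indep g F -> (#|F| <= d0)%N.

Definition std_index T : {set {ffun 'I_N -> 'I_T}} := [set c | indep g (exp_supp c)].

Lemma leq_expl x y e : (x <= y)%N -> (x ^ e <= y ^ e)%N.
Proof. by case: e => // e; rewrite leq_exp2r. Qed.

(** The exponents of a standard monomial are free on an independent set. *)
Lemma card_std_index T : (#|std_index T.+1| <= #|{set 'I_N}| * T.+1 ^ d0)%N.
Proof.
pose x := #|[pred a : 'I_T.+1 | val a != 0%N]|.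
have -> : #|std_index T.+1| = (\sum_(F : {set 'I_N} | indep g F) x ^ #|F|)%N.
  have := congr1 (fun p => p.[1]) (hilb_poly_supp g T).
  rewrite /hilb_poly !horner_sum /=.
  under eq_bigr do rewrite hornerXn expr1n.
  under [RHS]eq_bigr => F _.
    rewrite horner_exp horner_sum; under eq_bigr do rewrite hornerXn expr1n.
    rewrite sumr_const -natrX; over.
  rewrite -natr_sum sumr_const /= => /eqP; rewrite eqr_nat => /eqP <-.
  by apply: eq_card => c; rewrite inE.
rewrite -sum_nat_const big_mkcond; apply: leq_sum => F _; case: ifP => // iF.
apply: (@leq_trans (T.+1 ^ #|F|)); last by rewrite leq_pexp2l // le_d0.
by apply: leq_expl; rewrite (leq_trans (max_card _)) ?card_ord.
Qed.

Lemma mdeg_prod_le l (a : nat -> S) (e : 'I_l -> nat) M D :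
  (forall i : 'I_l, (e i < M)%N) ->
  (forall i : 'I_l, mon_ideal (fun m => mdeg m <= D)%N (a i)) ->
  mon_ideal (fun m => mdeg m <= l * (M * D))%N (\prod_(i < l) a i ^+ e i).
Proof.
move=> eM aD.
have mulD D1 D2 (p q : S) : mon_ideal (fun m => mdeg m <= D1)%N p ->
    mon_ideal (fun m => mdeg m <= D2)%N q -> mon_ideal (fun m => mdeg m <= D1 + D2)%N (p * q).
  move=> hp hq m; rewrite -mcoeff_msupp => /msuppM_le/allpairsP[[m1 m2] /= [m1p m2q ->]].
  by rewrite mdegD leq_add ?hp ?hq // -mcoeff_msupp.
have one0 D1 : mon_ideal (fun m => mdeg m <= D1)%N (1 : S).
  by move=> m; rewrite mcoeff1; have [->|_] := eqVneq m 0%MM; rewrite ?mdeg0 ?eqxx.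
have powD i k : mon_ideal (fun m => mdeg m <= k * D)%N (a (i : 'I_l) ^+ k).
  by elim: k => [|k IHk]; rewrite ?expr0 // exprS mulSn; apply: mulD.
have termD (i : 'I_l) : mon_ideal (fun m => mdeg m <= M * D)%N (a i ^+ e i).
  by move=> m /powD/leq_trans; apply; rewrite leq_mul2r (ltnW (eM i)) orbT.
suff prodD n (F : 'I_n -> S) :
    (forall i, mon_ideal (fun m => mdeg m <= M * D)%N (F i)) ->
    mon_ideal (fun m => mdeg m <= n * (M * D))%N (\prod_i F i) by exact: prodD.
elim: n F => [|n IHn] F hF.
  by rewrite big_ord0.
by rewrite big_ord_recl mulSn; apply: mulD => //; apply: IHn.
Qed.

(** More than [d0] elements are algebraically dependent modulo the ideal: among
    their monomials with exponents less than [M], there are [M ^ d0.+1], and they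
    live in a space of standard monomials whose dimension grows like
    [M ^ d0]. *)
Lemma prime_chain_le (I : S -> Prop) l P :
  (forall p, mon_ideal (nonstd g setT) p -> I p) ->
  prime_chain I l P -> (l <= d0)%N.
Proof.
move=> subI [primeP strictP]; rewrite leqNgt; apply/negP=> d0l.
have /fin_all_exists[a' a'P] (i : 'I_d0.+1) : exists x, P i.+1 x /\ ~ P i x.
  have [|_ [x Px nPx]] := strictP i; last by exists x.
  exact: leq_trans (ltn_ord i) d0l.
pose a i := a' (inord i).
have aP i : (i < d0.+1)%N -> P i.+1 (a i) /\ ~ P i (a i).
  by move=> id0; have := a'P (inord i); rewrite inordK.
(* [D] bounds the degrees of the [a i], hence [T] those of their monomials with
   exponents less than [M]; [M] is taken large enough for [M ^ d0.+1] to exceed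
   the number of standard monomials of degree at most [T]. *)
pose D := (\max_(i < d0.+1) msize (a i))%N.
have aD (i : 'I_d0.+1) : mon_ideal (fun m => mdeg m <= D)%N (a i).
  move=> m; rewrite -mcoeff_msupp => /msize_mdeg_lt/ltnW/leq_trans; apply.
  exact: (@leq_bigmax _ (fun i : 'I_d0.+1 => msize (a i)) i).
pose C := #|{set 'I_N}|; pose B := (d0.+1 * D).+1.
pose M := (C * B ^ d0).+1; pose T := (d0.+1 * (M * D))%N.
have TB : (T.+1 <= M * B)%N by rewrite /T /B mulnS mulnCA addnC -addn1 leq_add2l.
have leM : (#|std_index T.+1| < M ^ d0.+1)%N.
  apply: (leq_ltn_trans (card_std_index T)).
  apply: (@leq_ltn_trans (C * (M * B) ^ d0)); first by rewrite leq_mul2l leq_expl ?orbT.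
  by rewrite expnMn mulnCA expnSr ltn_pmul2l ?expn_gt0.
pose mon_t (t : d0.+1.-tuple 'I_M) := \prod_(i < d0.+1) a i ^+ tnth t i.
pose A : 'M[K]_(#|{: d0.+1.-tuple 'I_M}|, #|std_index T.+1|) :=
  \matrix_(i, j) (mon_t (enum_val i))@_(mnm_of (enum_val j)).
suff /eqP freeA : row_free A.
  have := rank_leq_col A; rewrite freeA card_tuple card_ord.
  by rewrite leqNgt leM.
apply: inj_row_free => v vA0; apply/rowP=> i; rewrite mxE -(enum_valK i).
apply: (@prime_chain_independent M d0.+1 P a (fun t => v 0 (enum_rank t))) => //.
- by move=> j jd0; have [] := primeP j (leq_trans jd0 d0l).
- by move=> j jd0; have [] := strictP j (leq_trans jd0 d0l).
have [_ IP0] := primeP 0%N isT; apply/IP0/subI => m pm.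
case: (boolP (nonstd g setT m)) => // std_m; exfalso.
have mT : (mdeg m < T.+1)%N.
  clear std_m; rewrite ltnS; move: m pm; apply: mon_ideal_sum => t _ m.
  rewrite mcoeffZ mulf_eq0 negb_or => /andP[_].
  exact: (@mdeg_prod_le _ a (fun i => tnth t i) M D (fun i => ltn_ord _) aD m).
have [c cm] := mnm_of_surj mT.
have c_std : c \in std_index T.+1.
  by move: std_m; rewrite negbK subsetT inE -cm mnm_supp_of.
move/rowP/(_ (enum_rank_in c_std c)): vA0; rewrite !mxE.
under eq_bigr do rewrite mxE enum_rankK_in // cm.
move=> p0; case/eqP: pm; rewrite -[RHS]p0 raddf_sum /=.
rewrite (big_enum_val (A := predT)) /=.
by apply: eq_bigr => j _; rewrite mcoeffZ enum_valK.
Qed.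

End PrimeChains.

(** * The independence polynomial at -1 *)

Section SignedCount.

Variables (V : finType) (g : rel V).
Hypotheses (g_sym : ssrbool.symmetric g) (g_irr : irreflexive g).

Implicit Types (A F : {set V}) (v x : V).

(** The value at -1 of the independence polynomial of the subgraph on [A]. *)
Definition signed_indep A : int :=
  \sum_(F : {set V} | indep g F && (F \subset A)) (-1) ^+ #|F|.

Lemma signed_indep_del A v : v \in A ->
  signed_indep A = signed_indep (A :\ v) - signed_indep (A :\: nbhd g v).
Proof.
move=> Av; rewrite /signed_indep (bigID (fun F => v \in F)) /= addrC; congr (_ + _).
  by apply: eq_bigl => F; rewrite subsetD1 andbA.
rewrite (reindex_onto (fun F => v |: F) (fun F => F :\ v)) /=; last first.
  by move=> F /andP[_ vF]; rewrite setD1K.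
rewrite -sumrN; apply: eq_big => [F|F /andP[_ /eqP FE]]; last first.
  have vF : v \notin F by rewrite -FE setD11.
  by rewrite cardsU1 vF exprS mulN1r.
rewrite setU11 andbT indepU1 // subUset sub1set Av /= subsetD.
have [vF|vF] := boolP (v \in F).
  have -> : ((v |: F) :\ v == F) = false.
    by apply/negbTE; apply: contraTneq vF => <-; rewrite setD11.
  rewrite andbF; apply/esym/negbTE/negP=> /andP[_ /andP[_ /disjointFr/(_ vF)]].
  by rewrite setU11.
rewrite setU1K // eqxx andbT -!andbA; congr (_ && _); rewrite andbC; congr (_ && _).
apply/idP/idP=> dF; last by apply: disjointWr dF; apply: subsetUr.
apply/pred0P=> y; rewrite /= in_setU1; case: eqP => [->|_]; first by rewrite (negPf vF).
by have /pred0P/(_ y) := dF.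
Qed.

Lemma signed_indep_isolated A x : x \in A -> (forall y, y \in A -> ~~ g x y) ->
  signed_indep A = 0.
Proof.
move=> Ax gx; rewrite (signed_indep_del Ax).
have -> : A :\: nbhd g x = A :\ x; last exact: subrr.
apply/setP=> y; rewrite !inE; case: eqP => //= _.
by case: (boolP (y \in A)) => [/gx/negPf->|]; rewrite ?andbF.
Qed.

(** Once [v] is deleted, [x] is isolated, and adding it to or removing it from an
    independent set cancels everything. *)
Lemma signed_indep_leaf A v x : v \in A -> x \in A -> v != x ->
  (forall y, y \in A -> g x y -> y = v) ->
  signed_indep A = - signed_indep (A :\: nbhd g v).
Proof.
move=> Av Ax vx gx; rewrite (signed_indep_del Av).
rewrite (@signed_indep_isolated _ x) ?sub0r //; first by rewrite in_setD1 eq_sym vx.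
by move=> y /setD1P[yv Ay]; apply: contraNN yv => /(gx y Ay) ->.
Qed.

Lemma signed_indep0 : signed_indep set0 = 1.
Proof.
rewrite /signed_indep (big_pred1 set0) ?cards0 ?expr0 // => F.
rewrite subset0 /=; case: eqP => [->|_]; last by rewrite andbF.
by rewrite indep0.
Qed.

End SignedCount.

(** * Cameron-Walker graphs *)

Section CameronWalker.

Variables (m n : nat) (s : 'I_m -> nat) (t : 'I_n -> nat).
Variable bip : 'I_m -> 'I_n -> bool.
Hypothesis s_gt0 : forall i, (0 < s i)%N.
Hypothesis w_nbr : forall j, exists i, bip i j.

Local Notation V := (cw_vertex s t).
Local Notation adj := (@cw_adj m n s t bip).

(** The [m + \sum_j t j] edges of an induced matching that is also a largest
    matching: one leaf edge at each [v_i], and the far edge of each triangle. *)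
Definition cw_edge := ('I_m + {j : 'I_n & 'I_(t j)})%type.

Definition cw_end (q : cw_edge) (b : bool) : V :=
  match q with
  | inl i => if b then CWx t (Ordinal (s_gt0 i)) else CWv s t i
  | inr u => CWy s (tagged u) b
  end.

Definition cw_end_inv (a : V) : option (cw_edge * bool) :=
  match a with
  | CWv i => Some (inl i, false)
  | CWx i _ => Some (inl i, true)
  | CWy j l b => Some (inr (Tagged (fun j => 'I_(t j)) l), b)
  | CWw _ => None
  end.

Lemma cw_endK q b : cw_end_inv (cw_end q b) = Some (q, b).
Proof. by case: q => [i|[j l]]; case: b. Qed.

Lemma cw_end_inj q b q' b' : cw_end q b = cw_end q' b' -> q = q' /\ b = b'.
Proof. by move/(congr1 cw_end_inv); rewrite !cw_endK => -[-> ->]. Qed.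

Lemma tagged_ord_eq (k : nat) (T : 'I_k -> nat) (u u' : {j : 'I_k & 'I_(T j)}) :
  (u == u') = (tag u == tag u') && (tagged u == tagged u' :> nat).
Proof.
case: u u' => j l [j' l'] /=; apply/eqP/andP=> [E|[/eqP jj]].
  split; apply/eqP; first exact: (congr1 tag E).
  exact: (congr1 (fun u : {j : 'I_k & 'I_(T j)} => tagged u : nat) E).
by case: _ / jj l' => l' /eqP/val_inj ->.
Qed.

Lemma cw_adj_end q b q' b' :
  adj (cw_end q b) (cw_end q' b') = (q == q') && (b != b').
Proof.
case: q q' => [i|u] [i'|u']; [| by case: b | by case: b' |].
  by case: b b' => [] [] /=; rewrite ?andbF ?andbT // eq_sym.
by rewrite [inr u == _]tagged_ord_eq -andbA.
Qed.

(** Edges at [v_i], resp. edges of one triangle, get the same colour. *)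
Definition cw_color (i0 : 'I_m) (a b : V) : cw_edge :=
  match a, b with
  | CWv i, _ => inl i
  | _, CWv i => inl i
  | CWy j l _, _ => inr (Tagged (fun j => 'I_(t j)) l)
  | _, CWy j l _ => inr (Tagged (fun j => 'I_(t j)) l)
  | _, _ => inl i0
  end.

Definition cw_triangle (u : {j : 'I_n & 'I_(t j)}) (x : option bool) : V :=
  if x is Some b then CWy s (tagged u) b else CWw s t (tag u).

Lemma cw_adj_color i0 a b : adj a b ->
  (exists2 i, cw_color i0 a b = inl i & a = CWv s t i \/ b = CWv s t i) \/
  (exists u x y, [/\ cw_color i0 a b = inr u, a = cw_triangle u x,
                     b = cw_triangle u y & x != y]).
Proof.
case: a b => [i|j|i k|j l c] [i'|j'|i' k'|j' l' c'] //=.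
- by left; exists i => //; left.
- by left; exists i => //; left.
- by left; exists i' => //; right.
- move=> /eqP->; right; exists (Tagged (fun j => 'I_(t j)) l'), None, (Some c').
  by split.
- by move=> /eqP->; left; exists i => //; right.
- by move=> /eqP->; right; exists (Tagged (fun j => 'I_(t j)) l), (Some c), None.
case/and3P=> /eqP jj; case: _ / jj l' => l' /eqP/val_inj <- cc'; right.
by exists (Tagged (fun j => 'I_(t j)) l), (Some c), (Some c').
Qed.

Lemma cw_color_meet i0 a b a' b' : adj a b -> adj a' b' ->
  cw_color i0 a b = cw_color i0 a' b' ->
  [\/ a' = a, a' = b, b' = a | b' = b].
Proof.
move=> /(cw_adj_color i0)[[i -> ab]|[u [x [y [-> -> -> xy]]]]]
  /(cw_adj_color i0)[[i' -> ab']|[u' [x' [y' [-> -> -> xy']]]]] //.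
  move=> -[ii']; rewrite -{}ii' in ab'.
  case: ab ab' => -> [] ->;
    by [constructor 1 | constructor 3 | constructor 2 | constructor 4].
move=> -[<-].
move: x y x' y' xy xy' => [[]|] [[]|] [[]|] [[]|] // _ _;
  by [constructor 1 | constructor 2 | constructor 3 | constructor 4].
Qed.

(** A clique cover: every independent set has at most one vertex in each class,
    and [cw_max] is a transversal of the classes that is independent. *)
Definition cw_class := ({i : 'I_m & 'I_(s i)} + {j : 'I_n & 'I_(maxn (t j) 1)})%type.

Lemma card_cw_class : #|{: cw_class}| = (\sum_i s i + \sum_j maxn (t j) 1)%N.
Proof.
rewrite card_sum !card_tagged !sumnE !big_map.
by congr (_ + _)%N; apply: eq_bigr => k _; rewrite card_ord.
Qed.

Lemma leq_maxn1 j : (t j <= maxn (t j) 1)%N.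
Proof. exact: leq_maxl. Qed.

Lemma maxn1_gt0 j : (0 < maxn (t j) 1)%N.
Proof. exact: leq_maxr. Qed.

Definition cw_class_of (a : V) : cw_class :=
  match a with
  | CWv i => inl (Tagged (fun i => 'I_(s i)) (Ordinal (s_gt0 i)))
  | CWx i k => inl (Tagged (fun i => 'I_(s i)) k)
  | CWw j => inr (Tagged (fun j => 'I_(maxn (t j) 1)) (Ordinal (maxn1_gt0 j)))
  | CWy j l _ => inr (Tagged (fun j => 'I_(maxn (t j) 1)) (widen_ord (leq_maxn1 j) l))
  end.

Lemma cw_class_adj a b : cw_class_of a = cw_class_of b -> a = b \/ adj a b.
Proof.
case: a b => [i|j|i k|j l c] [i'|j'|i' k'|j' l' c'] //= /eqP.
- by rewrite [_ == _]tagged_ord_eq /= => /andP[/eqP-> _]; left.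
- by rewrite [_ == _]tagged_ord_eq /= => /andP[-> _]; right.
- by rewrite [_ == _]tagged_ord_eq /= => /andP[/eqP-> _]; left.
- by rewrite [_ == _]tagged_ord_eq /= => /andP[-> _]; right.
- by rewrite [_ == _]tagged_ord_eq /= eq_sym => /andP[-> _]; right.
- rewrite [_ == _]tagged_ord_eq /= => /andP[/eqP ii].
  by case: _ / ii k' => k' /eqP/val_inj ->; left.
- by rewrite [_ == _]tagged_ord_eq /= eq_sym => /andP[-> _]; right.
rewrite [_ == _]tagged_ord_eq /= => /andP[/eqP jj].
case: _ / jj l' => l' /eqP/val_inj ->.
by have [->|cc'] := eqVneq c c'; [left | right; rewrite !eqxx].
Qed.

Definition cw_max (k : cw_class) : V :=
  match k with
  | inl u => CWx t (tagged u)
  | inr u => if (insub (val (tagged u)) : option 'I_(t (tag u))) is Some l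
             then CWy s l false else CWw s t (tag u)
  end.

Lemma maxn1_ge j (l : 'I_(maxn (t j) 1)) : ~~ (l < t j)%N -> t j = 0%N /\ l = 0%N :> nat.
Proof.
rewrite -leqNgt => tl; have := ltn_ord l.
rewrite leq_max ltnNge tl /= ltnS leqn0 => /eqP l0.
by move: tl; rewrite l0 leqn0 => /eqP.
Qed.

Lemma cw_maxK : cancel cw_max cw_class_of.
Proof.
case=> [[i k] //|[j l]] /=; case: insubP => [l' _ ll'|/maxn1_ge[_ l0]] /=.
  by apply/eqP; rewrite [_ == _]tagged_ord_eq /= eqxx ll' eqxx.
by apply/eqP; rewrite [_ == _]tagged_ord_eq /= eqxx l0.
Qed.

Lemma cw_max_indep k k' : ~~ adj (cw_max k) (cw_max k').
Proof.
case: k k' => [[i k]|[j l]] [[i' k']|[j' l']] //=;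
  case: insubP => [l1 _ _|/maxn1_ge[tj _]] //=.
- case: insubP => [l2 _ _|/maxn1_ge[tj _]] /=; first by rewrite !andbF.
  apply: contraTN isT => /eqP jj.
  by have := leq_ltn_trans (leq0n _) (ltn_ord l1); rewrite -jj tj.
case: insubP => [l2 _ _|] //=.
apply: contraTN isT => /eqP jj.
by have := leq_ltn_trans (leq0n _) (ltn_ord l2); rewrite -jj tj.
Qed.

Variables (U : finType) (g : rel U) (lab : V -> U).
Hypotheses (lab_bij : bijective lab) (labE : forall a b, g (lab a) (lab b) = adj a b).
Hypotheses (g_sym : ssrbool.symmetric g) (g_irr : irreflexive g).

Lemma cw_indep_le F : indep g F -> (#|F| <= \sum_i s i + \sum_j maxn (t j) 1)%N.
Proof.
move=> /indepP iF; have [inv labK invK] := lab_bij.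
rewrite -card_cw_class -(@card_in_imset _ _ (cw_class_of \o inv)); first exact: max_card.
move=> x y Fx Fy /= /cw_class_adj[]; first exact: (can_inj invK).
by rewrite -labE !invK; apply: contraTeq => _; apply: iF.
Qed.

Lemma cw_indep_max :
  exists2 F, indep g F & #|F| = (\sum_i s i + \sum_j maxn (t j) 1)%N.
Proof.
exists [set lab (cw_max k) | k : cw_class]; last first.
  by rewrite card_imset ?card_cw_class //; apply: inj_comp (bij_inj lab_bij) (can_inj cw_maxK).
apply/indepP=> x y /imsetP[k _ ->] /imsetP[k' _ ->].
by rewrite labE cw_max_indep.
Qed.

Lemma in_nbhd_end q b q' :
  (lab (cw_end q b) \in nbhd g (lab (cw_end q' false))) = (q == q').
Proof.
rewrite in_setU1 inE labE cw_adj_end [q' == q]eq_sym; have [->|qq'] := eqVneq q q'.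
  by case: b; rewrite ?orbT ?eqxx.
by rewrite orbF; apply: contraNF qq' => /eqP/(bij_inj lab_bij)/cw_end_inj[->].
Qed.

(** What is left of the graph after removing the closed neighbourhoods of the
    first ends of the matching edges in [ps]. *)
Definition cw_rest (ps : seq cw_edge) : {set U} :=
  [set x | all (fun q => x \notin nbhd g (lab (cw_end q false))) ps].

Definition cw_edges : seq cw_edge :=
  map inl (enum 'I_m) ++ map inr (enum {: {j : 'I_n & 'I_(t j)}}).

Lemma mem_cw_edges q : q \in cw_edges.
Proof.
rewrite mem_cat; case: q => [i|u]; apply/orP; [left | right];
  by apply/mapP; eexists; rewrite ?mem_enum.
Qed.

Lemma cw_edges_uniq : uniq cw_edges.
Proof.
rewrite cat_uniq; apply/and3P; split.
- by rewrite map_inj_uniq ?enum_uniq // => ? ? [].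
- by apply/hasPn=> q /mapP[u _ ->]; apply/negP=> /mapP[i _].
by rewrite map_inj_uniq ?enum_uniq // => ? ? [].
Qed.

(** The leaf edges come before the triangles: the vertices [w_j] must be gone for
    the far edge of a triangle to have a leaf. *)
Lemma cw_edges_order ps u qs i : cw_edges = ps ++ inr u :: qs -> inl i \in ps.
Proof.
move=> edgesE; pose is_inl (q : cw_edge) := if q is inl _ then true else false.
have : pairwise (fun q q' => is_inl q' ==> is_inl q) cw_edges.
  rewrite pairwise_cat; apply/and3P; split.
  - by apply/allrelP=> q q' /mapP[k _ ->] _; rewrite implybT.
  - by rewrite pairwise_map; elim: (enum _) => //= k ks ->; rewrite andbT; apply/allP.
  by rewrite pairwise_map; elim: (enum _) => //= k ks ->; rewrite andbT; apply/allP.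
rewrite edgesE pairwise_cat => /and3P[_ _] /= /andP[/allP noinl _].
have := mem_cw_edges (inl i); rewrite edgesE mem_cat in_cons => /or3P[//|//|].
by move/noinl.
Qed.

(** Each pair of a [v_i] and a leaf, and then each far edge of a triangle, is a
    vertex with a leaf in what is left: removing the closed neighbourhoods one
    after the other only changes the sign. *)
Lemma cw_signed_indep_neq0 : signed_indep g setT != 0.
Proof.
have [inv labK invK] := lab_bij.
have restP x ps : reflect (forall q, q \in ps -> x \notin nbhd g (lab (cw_end q false)))
    (x \in cw_rest ps).
  by rewrite inE; apply: (iffP allP).
have -> : setT = cw_rest [::] by apply/setP=> x; rewrite !inE.
suff H qs ps : cw_edges = ps ++ qs -> signed_indep g (cw_rest ps) != 0 by exact: (H cw_edges [::]).
elim: qs ps => [|q qs IHqs] ps edgesE.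
  have -> : cw_rest ps = set0; last by rewrite signed_indep0.
  rewrite cats0 in edgesE; apply/setP=> x; rewrite [RHS]inE; apply/negbTE/negP.
  move/restP; rewrite -(invK x) -edgesE => nbh.
  have {}nbh q := negP (nbh q (mem_cw_edges q)).
  case: (inv x) nbh => [i|j|i k|j l b] nbh.
  - by apply: (nbh (inl i)); rewrite setU11.
  - have [i ij] := w_nbr j.
    by apply: (nbh (inl i)); rewrite in_setU1 inE labE /= ij orbT.
  - by apply: (nbh (inl i)); rewrite in_setU1 inE labE /= eqxx orbT.
  apply: (nbh (inr (Tagged (fun j => 'I_(t j)) l))).
  by rewrite -[CWy _ _ _]/(cw_end (inr (Tagged (fun j => 'I_(t j)) l)) b) in_nbhd_end.
have qps : q \notin ps.
  have := cw_edges_uniq; rewrite edgesE cat_uniq => /and3P[_ /hasPn/(_ q) nq _].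
  by apply: nq; rewrite in_cons eqxx.
have endA b : lab (cw_end q b) \in cw_rest ps.
  by apply/restP=> q' q'ps; rewrite in_nbhd_end; apply: contraNneq qps => ->.
rewrite (signed_indep_leaf g_sym g_irr (endA false) (endA true)).
- rewrite oppr_eq0; have -> : cw_rest ps :\: nbhd g (lab (cw_end q false)) = cw_rest (rcons ps q).
    by apply/setP=> x; rewrite in_setD [x \in cw_rest ps]inE [RHS]inE all_rcons.
  by apply: IHqs; rewrite cat_rcons.
- by apply/eqP => /(bij_inj lab_bij)/cw_end_inj[].
move=> y; rewrite -(invK y) labE; move: (inv y) => a.
case: q edgesE {qps endA} => [i|u] edgesE /restP nbh.
  by case: a {nbh} => [i'|j'|i' k'|j' l' b'] //= /eqP->.
case: a nbh => [i'|j'|i' k'|j' l' b'] //= nbh.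
  move=> /eqP jj; have [i ij] := w_nbr j'; have := nbh (inl i) (cw_edges_order i edgesE).
  by rewrite in_setU1 inE labE /= ij orbT.
rewrite [_ && _]andbA; case: u edgesE => j l edgesE /=.
case/andP=> /andP[/eqP jj]; case: _ / jj l' {nbh} => l' /eqP/val_inj <-.
by case: b'.
Qed.

End CameronWalker.

(** * Degree and regularity of a Cameron-Walker graph *)

Section EdgeIdeal.

Variables (K : fieldType) (T : finType) (e : rel T).

Definition ord_graph : rel 'I_#|T| := fun i j => e (enum_val i) (enum_val j).

(** A monomial lies in the edge ideal if and only if its support contains an
    edge. *)
Lemma edge_idealP p : irreflexive e ->
  edge_ideal K e p <-> mon_ideal (nonstd ord_graph setT) p.
Proof.
move=> e_irr; split=> [[c ->]|].
  apply: mon_ideal_sum => x _; apply: mon_ideal_sum => y exy.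
  apply: mon_idealM; first exact: nonstd_up.
  move=> m; rewrite -mpolyXD mcoeffX; case: (eqVneq _ m) => [<- _|_]; last by rewrite eqxx.
  rewrite /nonstd subsetT /=; apply/indepP=> /(_ (enum_rank x) (enum_rank y)).
  rewrite mnm_suppD !mnm_suppU !inE !eqxx orbT /ord_graph !enum_rankK exy.
  by move/(_ isT isT).
have edgeD q q' : edge_ideal K e q -> edge_ideal K e q' -> edge_ideal K e (q + q').
  move=> [c ->] [c' ->]; exists (fun x y => c x y + c' x y).
  rewrite -big_split; apply: eq_bigr => x _; rewrite -big_split.
  by apply: eq_bigr => y _; rewrite mulrDl.
have edge0 : edge_ideal K e 0.
  by exists (fun _ _ => 0); rewrite big1 // => x _; rewrite big1 // => y _; rewrite mul0r.
have edgeX q x y : e x y -> edge_ideal K e (q * ('X_(enum_rank x) * 'X_(enum_rank y))).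
  move=> exy; exists (fun x' y' => if (x' == x) && (y' == y) then q else 0).
  rewrite (bigD1 x) //= (bigD1 y) //= !eqxx /= [X in _ + X + _]big1 => [|y' /andP[_ /negPf ->]].
    by rewrite big1 ?addr0 // => x' /negPf ->; rewrite big1 // => y' _; rewrite mul0r.
  by rewrite mul0r.
move=> Ip; rewrite [p]mpolyE big_seq; apply: big_ind => // m; rewrite mcoeff_msupp.
move=> /Ip; rewrite /nonstd subsetT /=.
case/forall_inPn=> i mi /forall_inPn[j mj]; rewrite negbK => gij.
have ij : i != j by apply: contraTneq gij => ->; rewrite /ord_graph e_irr.
have -> : p@_m *: 'X_[m] = (p@_m *: 'X_[m - (U_(i) + U_(j))]) *
    ('X_(enum_rank (enum_val i)) * 'X_(enum_rank (enum_val j))).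
  rewrite !enum_valK -scalerAl -!mpolyXD submK //.
  apply/mnm_lepP=> k; rewrite mnmDE !mnm1E; move: mi mj; rewrite !inE -!lt0n.
  have [<-|_] := eqVneq i k; last by have [<-|_] := eqVneq j k.
  by rewrite [j == i]eq_sym (negPf ij).
exact: edgeX.
Qed.

End EdgeIdeal.

(** The hypotheses provide an induced matching and a partition of the edges into
    pairwise intersecting ones, both indexed by [Q]: the lower and the upper
    bound for the regularity coincide. *)
Lemma regularity_matching (K : fieldType) N (g : rel 'I_N) (Q : finType)
    (P : Q -> bool -> 'I_N) (col : 'I_N -> 'I_N -> Q) (I : {mpoly K[N]} -> Prop) r :
  ssrbool.symmetric g -> irreflexive g ->
  (forall q b q' b', P q b = P q' b' -> q = q' /\ b = b') ->
  (forall q b q' b', g (P q b) (P q' b') = (q == q') && (b != b')) ->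
  (forall i j k l, g i j -> g k l -> col i j = col k l ->
     (k \in [set i; j]) || (l \in [set i; j])) ->
  (forall p, I p <-> mon_ideal (nonstd g setT) p) ->
  regularity I r -> r = #|Q|.
Proof.
move=> g_sym g_irr P_inj gP col_inter IE [F [resF [i0 betti_r] betti_le]].
(* Only the order of the generators matters from here on. *)
have [E posE] : exists E : exterior_basis N, @eb_pos _ E =1 matching_pos P.
  by exists (ExteriorBasis (@enum_rankK {set 'I_N}) (@enum_valK {set 'I_N})
    (@matching_pos_inj _ _ P)).
have upB := @nonstd_up N g setT.
apply/eqP; rewrite eqn_leq; apply/andP; split.
  have [k] : exists k : 'I_(rank F i0), shift k == (i0 + r)%N.
    have : #|[set k : 'I_(rank F i0) | shift k == (i0 + r)%N]| != 0%N by apply/eqP.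
    by rewrite cards_eq0 => /set0Pn[k]; rewrite inE; exists k.
  have kregQ : kreg K E (nonstd g setT) #|Q|.
    apply: (@kregW _ _ E _ #|edge_colors g col setT|); first exact: max_card.
    exact: kreg_nonstd.
  move=> /eqP kE; have := shift_le_kreg upB IE resF k kregQ.
  by rewrite kE leq_add2l.
rewrite leqNgt; apply/negP=> r_lt.
have shift_le p (k : 'I_(rank F p)) : (shift k <= p + r)%N.
  have [kp|pk] := leqP (shift k) p; first by rewrite (leq_trans kp) ?leq_addr.
  rewrite -(subnKC (ltnW pk)) leq_add2l; apply: (betti_le p).
  rewrite subnKC ?(ltnW pk) // => /eqP; rewrite cards_eq0 => /eqP/setP/(_ k).
  by rewrite !inE eqxx.
case EQ: #|Q| r_lt => [//|j]; rewrite ltnS => rj.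
have hz := @homog_matching_cycle K N Q P E; rewrite EQ in hz.
have [w] := kreg_shift_le upB IE resF shift_le rj hz (@matching_cycleP K N g Q P gP E).
exact: matching_cycle_not_boundary.
Qed.

Theorem theorem3p1 (K : fieldType) (T : finType) (e : rel T) (m n : nat)
  (s : 'I_m -> nat) (t : 'I_n -> nat) (bip : 'I_m -> 'I_n -> bool)
  (lab : cw_vertex s t -> T) (h : {poly int}) (r : nat) :
  cameron_walker e bip lab ->
  h_polynomial (edge_ideal K e) h ->
  regularity (edge_ideal K e) r ->
  (r <= (size h).-1)%N /\
  ((size h).-1 = r <->
     (forall i : 'I_m, s i = 1%N) /\ (forall j : 'I_n, (1 <= t j)%N)).
Proof.
move=> cw hP regP; have [e_sym e_irr] := cw_simple cw.
pose g := ord_graph e; pose lab' a : 'I_#|T| := enum_rank (lab a).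
have g_sym : ssrbool.symmetric g by move=> i j; apply: e_sym.
have g_irr : irreflexive g by move=> i; apply: e_irr.
have lab'_bij : bijective lab' by apply: bij_comp (cw_lab_bij cw); apply: enum_rank_bij.
have lab'E a b : g (lab' a) (lab' b) = cw_adj bip a b.
  by rewrite /g /ord_graph !enum_rankK (cw_labE cw).
have s_gt0 := cw_s_gt0 cw; have IE (p : {mpoly K[#|T|]}) := edge_idealP p e_irr.
pose i0 := Ordinal (cw_m_gt0 cw).
have w_nbr j : exists i, bip i j.
  have /connectP[[//|[i|//] p] /= /andP[ij _] _] := cw_bip_connected cw (inr j) (inl i0).
  by exists i.
pose d0 := (\sum_i s i + \sum_j maxn (t j) 1)%N.
have size_h : size h = d0.+1.
  have [H [d [HP [[P chainP] _] hE]]] := hP.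
  have indep_le := cw_indep_le s_gt0 lab'_bij lab'E.
  have d_le : (d <= d0)%N by apply: (prime_chain_le indep_le _ chainP) => p /IE.
  rewrite (h_poly_supp_poly _ hE indep_le (cw_indep_max s_gt0 lab'_bij lab'E) d_le).
    apply: size_supp_poly indep_le _.
    have := cw_signed_indep_neq0 s_gt0 w_nbr lab'_bij lab'E g_sym g_irr.
    by rewrite /signed_indep; under eq_bigl do rewrite subsetT andbT.
  by move=> k M kM; apply: quot_dim_unique IE kM (HP k).
have rE : r = (m + \sum_j t j)%N.
  have [inv labK invK] := lab'_bij.
  rewrite (@regularity_matching K _ g (cw_edge m t) (fun q b => lab' (cw_end s_gt0 q b))
    (fun x y => cw_color i0 (inv x) (inv y)) (edge_ideal K e) r) //.
  - rewrite card_sum card_ord card_tagged sumnE big_map big_enum /=.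
    by congr (_ + _)%N; apply: eq_bigr => j _; rewrite card_ord.
  - by move=> q b q' b' /(bij_inj lab'_bij)/cw_end_inj.
  - by move=> q b q' b'; rewrite lab'E cw_adj_end.
  move=> x y z u; rewrite -(invK x) -(invK y) -(invK z) -(invK u) !lab'E !labK.
  by move=> xy zu /(cw_color_meet xy zu)[]->; rewrite !inE eqxx ?orbT.
have sum_s : (\sum_(i < m) 1 <= \sum_i s i ?= iff [forall i, s i == 1%N])%N.
  by apply: leqif_sum => i _; split; [apply: s_gt0 | rewrite eq_sym].
rewrite sum1_card card_ord in sum_s.
have sum_t : (\sum_j t j <= \sum_j maxn (t j) 1 ?= iff [forall j, (1 <= t j)%N])%N.
  apply: leqif_sum => j _; split; first exact: leq_maxl.
  by rewrite eq_sym; apply/eqP/idP => [<-|/maxn_idPl //]; apply: leq_maxr.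
rewrite size_h /= rE; have [le_d eq_d] := leqif_add sum_s sum_t; split=> //.
split=> [/esym/eqP|[s1 t1]].
  by rewrite eq_d => /andP[/forallP s1 /forallP t1]; split=> // i; apply/eqP.
apply/esym/eqP; rewrite eq_d; apply/andP; split; apply/forallP=> k; last exact: t1.
by rewrite s1.
Qed.
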